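(* Let $(\mathbf u,p,T)\in V\times Q\times W$ be the unique solution of the continuous weak problem (P), with $(\mathbf u,p,T)\in (X\cap H^3(\Omega)^2)\times(Q\cap H^2(\Omega))\times(W\cap H^3(\Omega))$. Let $(\mathbf u_h,p_h,T_h)\in X_h\times Q_h\times R_h$ be a solution of the discrete problem (P$_h$). Let $R$ be the stability bound of the weak solutions, i.e. $|\mathbf u|_{1,\Omega},|T|_{1,\Omega},|\mathbf u_h|_{1,\Omega},|T_h|_{1,\Omega}\le R$ ($R$ depends on the norm of the source term $f$). Put $$L_1=\frac{r\,m\,Pr}{2}-(N_1+N_2)R-g\,Pr\,Ra\,c^2,\qquad L_2=\frac{a}{2}-\frac{g\,Pr\,Ra\,c^2}{2}-5N_2R,$$ $$K_1=\frac{3\,r\,m\,Pr}{2}+\frac{6(N_1R)^2}{r\,m\,Pr}+N_2R,\qquad K_2=\frac{3\,r}{2\,m\,Pr},\qquad K_3=N_2R+\frac{g\,Pr\,Ra\,c^2}{2}+\frac{a}{2},$$ and assume $L_1>0$ and $L_2>0$. Then there are constants $C_1,C_2>0$, independent of $h$ and of $(\mathbf u,p,T)$ and $(\mathbf u_h,p_h,T_h)$ (they may depend on $\Omega$, the mesh family, the physical parameters and $R$), such that $$|\mathbf u-\mathbf u_h|_{1,\Omega}\le \frac{C_1h^2}{\sqrt{L_1}}\left(\sqrt{K_1}\,|\mathbf u|_3+\sqrt{K_3}\,|T|_3\right)+C_2h^2\sqrt{K_2}\,|p|_2,$$ $$|T-T_h|_{1,\Omega}\le \frac{C_1h^2}{\sqrt{L_2}}\left(\sqrt{K_1}\,|\mathbf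 u|_3+\sqrt{K_3}\,|T|_3\right)+C_2h^2\sqrt{K_2}\,|p|_2.$$
   Context: $\Omega\subset\mathbb R^2$ is a bounded connected domain with Lipschitz boundary. The physical parameters $Pr,Ra>0$ and $\rho_f,\rho_{hnf},\mu_f,\mu_{hnf},\beta_f,(\rho\beta)_{hnf},\alpha_f,\alpha_{hnf}>0$ are given (subscripts: $f$ = base fluid, $hnf$ = hybrid nanofluid). Abbreviate $r=\rho_f/\rho_{hnf}$, $m=\mu_{hnf}/\mu_f$, $g=(\rho\beta)_{hnf}/(\rho_{hnf}\beta_f)$, $a=\alpha_{hnf}/\alpha_f$. Let $j=(0,1)$ and $f\in L^2(\Omega)$. Spaces: $V=H^1_0(\Omega)^2$, $W=H^1_0(\Omega)$, $Q=L^2_0(\Omega)=\{q\in L^2(\Omega):\int_\Omega q=0\}$, $X=\{\mathbf v\in V:\operatorname{div}\mathbf v=0\}$. $\|\cdot\|_2$ (also written $\|\cdot\|_0$) is the $L^2(\Omega)$ norm, $|v|_{1,\Omega}=\|\nabla v\|_2$, and $|\cdot|_k$ is the $H^k(\Omega)$ seminorm ($L^2$ norm of all derivatives of order exactly $k$). Forms: $a_0(\mathbf u,\mathbf v)=r\,m\,Pr\int_\Omega\nabla\mathbf u\cdot\nabla\mathbf v$; $a_1(\mathbf w;\mathbf u,\mathbf v)=\sum_{i,j=1}^2\int_\Omega w_j\frac{\partial u_i}{\partial x_j}v_i$; $a_2(T,\mathbf v)=g\,Pr\,Ra\int_\Omega (jT)\cdot\mathbf v$; $a_3(T,\theta)=a\int_\Omega\nabla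 T\cdot\nabla\theta$; $a_4(\mathbf u;T,\theta)=\int_\Omega(\mathbf u\cdot\nabla T)\theta$; $b(\mathbf v,q)=r\int_\Omega(\nabla\cdot\mathbf v)q$. Constants: $N_1,N_2\ge0$ depend only on $\Omega$ and satisfy $|a_1(\mathbf w;\mathbf u,\mathbf v)|\le N_1|\mathbf w|_{1,\Omega}|\mathbf u|_{1,\Omega}|\mathbf v|_{1,\Omega}$ and $|a_4(\mathbf u;T,\theta)|\le N_2|\mathbf u|_{1,\Omega}|T|_{1,\Omega}|\theta|_{1,\Omega}$ for all $\mathbf u,\mathbf v,\mathbf w\in V$, $T,\theta\in W$. $c$ is the Poincaré constant: $\|v\|_2\le c\|\nabla v\|_2$ for $v$ in $H_0^1(\Omega)$ (and in $H^1_0(\Omega)^2$). Problem (P): find $(\mathbf u,p,T)\in V\times Q\times W$ such that for all $(\mathbf v,q,\theta)\in V\times Q\times W$ $$a_0(\mathbf u,\mathbf v)+a_1(\mathbf u;\mathbf u,\mathbf v)-b(\mathbf v,p)-a_2(T,\mathbf v)+a_3(T,\theta)+a_4(\mathbf u;T,\theta)=\int_\Omega f\theta,\qquad b(\mathbf u,q)=0.$$ This is the weak form (with homogeneous boundary conditions $\mathbf u=\mathbf 0$, $T=0$ on $\partial\Omega$ and a source term $f$ in the energy equation) of the modified Navier–Stokes equations coupled with the energy equation for a hybrid nanofluid. Finite elements: for each mesh size $h$ in a family of meshes, $\tau_h$ is a finite element partition of $\Omega$ (so $\Omega=\bigcup_{K\in\tau_h}K$), $P_k(K)$ denotes polynomials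 of degree $k$ on $K$ (i.e. at most $k$), and $X_h=\{\mathbf v_h\in V\cap C^0(\Omega)^2:\mathbf v_h|_K\in P_2(K)^2\ \forall K\in\tau_h\}$, $Q_h=\{q_h\in Q:q_h|_K\in P_1(K)\ \forall K\in\tau_h\}$, $R_h=\{T_h\in W\cap C^0(\Omega):T_h|_K\in P_2(K)\ \forall K\in\tau_h\}$. Problem (P$_h$): find $(\mathbf u_h,p_h,T_h)\in X_h\times Q_h\times R_h$ such that for all $(\mathbf v_h,q_h,\theta_h)\in X_h\times Q_h\times R_h$ $$a_0(\mathbf u_h,\mathbf v_h)+a_1(\mathbf u_h;\mathbf u_h,\mathbf v_h)-b(\mathbf v_h,p_h)-a_2(T_h,\mathbf v_h)+a_3(T_h,\theta_h)+a_4(\mathbf u_h;T_h,\theta_h)=\int_\Omega f\theta_h,\qquad b(\mathbf u_h,q_h)=0.$$ Standing assumptions on the discretization: (i) discrete inf-sup condition: there is $L>0$, independent of $h$, with $\inf_{0\ne q_h\in Q_h}\sup_{\mathbf 0\ne\mathbf v_h\in X_h}\frac{(\nabla\cdot\mathbf v_h,q_h)}{|\mathbf v_h|_{1,\Omega}\|q_h\|_2}\ge L$, where $(\cdot,\cdot)$ is the $L^2(\Omega)$ inner product; (ii) interpolation estimates: there is $C>0$, independent of $h$, such that for all $\mathbf u\in X\cap H^3(\Omega)^2$, $T\in W\cap H^3(\Omega)$, $p\in Q\cap H^2(\Omega)$: $\inf_{\mathbf v_h\in X_h}\{\|\mathbf u-\mathbf v_h\|_0+h\|\nabla(\mathbf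 u-\mathbf v_h)\|_0\}\le Ch^3|\mathbf u|_3$, $\inf_{S_h\in R_h}\{\|T-S_h\|_0+h\|\nabla(T-S_h)\|_0\}\le Ch^3|T|_3$, $\inf_{q_h\in Q_h}\|p-q_h\|_0\le Ch^2|p|_2$. *)

(* Defs.v *)
From HB Require Import structures.
From mathcomp Require Import all_boot all_order all_algebra.
From mathcomp Require Import all_classical all_reals all_analysis.

Set Implicit Arguments.
Unset Strict Implicit.
Unset Printing Implicit Defensive.

Import Order.TTheory GRing.Theory Num.Theory.
Import numFieldNormedType.Exports.

Local Open Scope classical_set_scope.
Local Open Scope ring_scope.

Section Geometry.
Variable R : realType.
Implicit Types (D Omega K : set (R * R)).

(* The norm of [R * R] in the library is the sup norm, whence an explicit
   Euclidean distance. *)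
Definition edist (x y : R * R) : R :=
  Num.sqrt ((x.1 - y.1) ^+ 2 + (x.2 - y.2) ^+ 2).

(* Near each boundary point and in a suitable rotated orthonormal frame
   [(c, s), (- s, c)], the open set [D] is the strict epigraph of a Lipschitz
   function. *)
Definition lipschitz_boundary D : Prop :=
  forall x, (closure D `\` D) x ->
  exists (c s k : R) (gamma : R -> R),
    [/\ c ^+ 2 + s ^+ 2 = 1, k.-lipschitz gamma &
        \forall y \near x,
          D y <-> gamma (c * y.1 + s * y.2) < - s * y.1 + c * y.2].

Record bounded_lipschitz_domain Omega : Prop := {
  domain_nonempty : Omega !=set0;
  domain_open : open Omega;
  domain_connected : connected Omega;
  domain_bounded : bounded_set Omega;
  domain_lipschitz : lipschitz_boundary Omega }.

(* Ciarlet's axioms of a finite element partition.  The elements are closed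
   and [Omega] is open, so that they cover the closure of [Omega].  No shape
   of the elements is imposed. *)
Record fe_partition Omega (tau : set (set (R * R))) : Prop := {
  fe_finite : finite_set tau;
  fe_cover : \bigcup_(K in tau) K = closure Omega;
  fe_closed : forall K, tau K -> closure K° = K;
  fe_nonempty : forall K, tau K -> K° !=set0;
  fe_lipschitz : forall K, tau K -> lipschitz_boundary K°;
  fe_disjoint : forall K K', tau K -> tau K' -> K <> K' -> K° `&` K'° = set0 }.

(* the largest diameter of the elements *)
Definition mesh_size (tau : set (set (R * R))) : R :=
  sup [set d | exists K x y, [/\ tau K, K x, K y & d = edist x y]].

End Geometry.

Section FunctionSpaces.
Variables (R : realType) (Omega : set (R * R)).
Implicit Types (u g phi f q : R * R -> R) (v w : 'I_2 -> R * R -> R).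
Implicit Types (s : seq 'I_2) (k : nat).

Definition leb2 : {measure set (measurableTypeR R * measurableTypeR R) -> \bar R} :=
  (@lebesgue_measure R \x @lebesgue_measure R)%E.

Definition integ f : R := \int[leb2]_(x in Omega) f x.

(* Functions are representatives defined on the whole plane; only their
   values in [Omega], up to a null set, matter. *)
Definition ae_eq_on (f g : R * R -> R) : Prop :=
  {ae leb2, forall x, Omega x -> f x = g x}.

Definition L2 : set (R * R -> R) :=
  [set f | f \_ Omega \in Lfun leb2 2%:E].

Definition L2norm f : R := fine ('N[leb2]_2%:E[EFin \o (f \_ Omega)])%E.

Definition e_ (i : 'I_2) : R * R := ((i == 0)%:R, (i == 1)%:R).

(* A derivative of order [size s] is indexed by the word [s] of its
   directions. *)
Definition iterD s phi : R * R -> R := foldr (fun i f => 'D_(e_ i) f) phi s.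

Definition smooth phi : Prop :=
  forall s, continuous (iterD s phi) /\
            forall i x, derivable (iterD s phi) x (e_ i).

Definition test_function phi : Prop :=
  [/\ smooth phi, compact (closure [set x | phi x != 0]) &
      closure [set x | phi x != 0] `<=` Omega].

Definition is_wderiv s u g : Prop :=
  L2 g /\
  forall phi, test_function phi ->
    integ (fun x => u x * iterD s phi x) =
    (-1) ^+ size s * integ (fun x => g x * phi x).

(* the weak derivative in [L2], unique up to a null set when it exists; the
   null function by convention when it does not *)
Definition wderiv s u : R * R -> R := xget (cst 0) [set g | is_wderiv s u g].

Definition dx (i : 'I_2) u : R * R -> R := wderiv [:: i] u.

Definition Hk k : set (R * R -> R) :=
  [set u | L2 u /\ forall s, (size s <= k)%N -> exists g, is_wderiv s u g].

(* one term for each multi-index [(i, k - i)] of order [k] *)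
Definition snorm k u : R :=
  Num.sqrt (\sum_(i < k.+1)
    L2norm (wderiv (nseq i (0 : 'I_2) ++ nseq (k - i) (1 : 'I_2)) u) ^+ 2).

Definition H1norm u : R := Num.sqrt (L2norm u ^+ 2 + snorm 1 u ^+ 2).

(* the closure in [H^1] of the test functions *)
Definition H10 : set (R * R -> R) :=
  [set u | Hk 1 u /\
    forall eps : R, 0 < eps ->
      exists2 phi, test_function phi & H1norm (u \- phi) < eps].

Definition L20 : set (R * R -> R) := [set q | L2 q /\ integ q = 0].

Definition vsub v w : 'I_2 -> R * R -> R := fun i => v i \- w i.

Definition vL2norm v : R := Num.sqrt (\sum_(i < 2) L2norm (v i) ^+ 2).

Definition vsnorm k v : R := Num.sqrt (\sum_(i < 2) snorm k (v i) ^+ 2).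

Definition vHk k : set ('I_2 -> R * R -> R) := [set v | forall i, Hk k (v i)].

Definition vH10 : set ('I_2 -> R * R -> R) := [set v | forall i, H10 (v i)].

Definition wdiv v : R * R -> R := fun x => \sum_(i < 2) dx i (v i) x.

Definition divfree : set ('I_2 -> R * R -> R) :=
  [set v | vH10 v /\ ae_eq_on (wdiv v) (cst 0)].

(* polynomials of total degree at most [k] *)
Definition polyfun k (coef : nat -> nat -> R) : R * R -> R := fun x =>
  \sum_(i < k.+1) \sum_(j < k.+1 | (i + j <= k)%N)
    coef i j * x.1 ^+ i * x.2 ^+ j.

(* Equality on the closed set [K] is almost everywhere: two elements share
   boundary points, and an element of [Qh] below may jump across them. *)
Definition poly_on k (K : set (R * R)) f : Prop :=
  exists coef, {ae leb2, forall x, K x -> f x = polyfun k coef x}.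

Variable tau : set (set (R * R)).

Definition Rh : set (R * R -> R) :=
  [set T | [/\ H10 T, {within Omega, continuous T} &
               forall K, tau K -> poly_on 2 K T]].

Definition Xh : set ('I_2 -> R * R -> R) :=
  [set v | [/\ vH10 v, forall i, {within Omega, continuous (v i)} &
               forall i K, tau K -> poly_on 2 K (v i)]].

Definition Qh : set (R * R -> R) :=
  [set q | L20 q /\ forall K, tau K -> poly_on 1 K q].

Definition inf_sup_quotient v q : R :=
  integ (fun x => wdiv v x * q x) / (vsnorm 1 v * L2norm q).

(* The infimum and the supremum are taken in the extended reals; functions
   are nonzero when they are not null almost everywhere. *)
Definition inf_sup_condition (L : R) : Prop :=
  let Xh_nonzero := [set v | Xh v /\ ~ (forall i, ae_eq_on (v i) (cst 0))] in
  let Qh_nonzero := [set q | Qh q /\ ~ ae_eq_on q (cst 0)] in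
  (L%:E <= ereal_inf [set ereal_sup [set (inf_sup_quotient v q)%:E
                                    | v in Xh_nonzero] | q in Qh_nonzero])%E.

Record interpolation_estimates (C : R) : Prop := {
  interp_velocity : forall u : 'I_2 -> R * R -> R, divfree u -> vHk 3 u ->
    inf [set vL2norm (vsub u v) + mesh_size tau * vsnorm 1 (vsub u v)
        | v in Xh]
      <= C * mesh_size tau ^+ 3 * vsnorm 3 u;
  interp_temperature : forall T, H10 T -> Hk 3 T ->
    inf [set L2norm (T \- S) + mesh_size tau * snorm 1 (T \- S) | S in Rh]
      <= C * mesh_size tau ^+ 3 * snorm 3 T;
  interp_pressure : forall p, L20 p -> Hk 2 p ->
    inf [set L2norm (p \- q) | q in Qh] <= C * mesh_size tau ^+ 2 * snorm 2 p }.

End FunctionSpaces.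

(* subscripts: [f] for the base fluid, [hnf] for the hybrid nanofluid;
   [rhobeta_hnf] is a single quantity, not a product *)
Record nanofluid (R : realType) := Nanofluid {
  Pr : R; Ra : R;
  rho_f : R; rho_hnf : R;
  mu_f : R; mu_hnf : R;
  beta_f : R; rhobeta_hnf : R;
  alpha_f : R; alpha_hnf : R;
  Pr_gt0 : 0 < Pr; Ra_gt0 : 0 < Ra;
  rho_f_gt0 : 0 < rho_f; rho_hnf_gt0 : 0 < rho_hnf;
  mu_f_gt0 : 0 < mu_f; mu_hnf_gt0 : 0 < mu_hnf;
  beta_f_gt0 : 0 < beta_f; rhobeta_hnf_gt0 : 0 < rhobeta_hnf;
  alpha_f_gt0 : 0 < alpha_f; alpha_hnf_gt0 : 0 < alpha_hnf }.

Section Problem.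
Variables (R : realType) (Omega : set (R * R)) (P : nanofluid R).
Implicit Types (u v w : 'I_2 -> R * R -> R) (T theta f p q : R * R -> R).

Definition ratio_r : R := rho_f P / rho_hnf P.
Definition ratio_m : R := mu_hnf P / mu_f P.
Definition ratio_g : R := rhobeta_hnf P / (rho_hnf P * beta_f P).
Definition ratio_a : R := alpha_hnf P / alpha_f P.

Local Notation r := ratio_r.
Local Notation m := ratio_m.
Local Notation g := ratio_g.
Local Notation a := ratio_a.
Local Notation Pr := (Pr P).
Local Notation Ra := (Ra P).
Local Notation "\integral F" := (integ Omega F) (at level 36).
Local Notation d_ := (dx Omega).

(* the components of the vector (0, 1) *)
Definition jvec (i : 'I_2) : R := (i == 1)%:R.

Definition a0 u v : R :=
  r * m * Pr *
  \integral (fun x => \sum_(i < 2) \sum_(j < 2) d_ j (u i) x * d_ j (v i) x).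

Definition a1 w u v : R :=
  \sum_(i < 2) \sum_(j < 2)
    \integral (fun x => w j x * d_ j (u i) x * v i x).

Definition a2 T v : R :=
  g * Pr * Ra * \integral (fun x => \sum_(i < 2) jvec i * T x * v i x).

Definition a3 T theta : R :=
  a * \integral (fun x => \sum_(j < 2) d_ j T x * d_ j theta x).

Definition a4 u T theta : R :=
  \integral (fun x => (\sum_(j < 2) u j x * d_ j T x) * theta x).

Definition b v q : R := r * \integral (fun x => wdiv Omega v x * q x).

(* The same variational problem, posed in the spaces [VS], [QS], [WS]. *)
Record solution (VS : set ('I_2 -> R * R -> R)) (QS WS : set (R * R -> R))
    f u p T : Prop := {
  sol_u : VS u;
  sol_p : QS p;
  sol_T : WS T;
  sol_eq : forall v q theta, VS v -> QS q -> WS theta ->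
    a0 u v + a1 u u v - b v p - a2 T v + a3 T theta + a4 u T theta
      = \integral (fun x => f x * theta x)
    /\ b u q = 0 }.

Definition continuous_solution := solution (vH10 Omega) (L20 Omega) (H10 Omega).

Definition discrete_solution (tau : set (set (R * R))) :=
  solution (Xh Omega tau) (Qh Omega tau) (Rh Omega tau).

Definition unique_continuous_solution f u p T : Prop :=
  continuous_solution f u p T /\
  forall u' p' T', continuous_solution f u' p' T' ->
    [/\ forall i, ae_eq_on Omega (u' i) (u i), ae_eq_on Omega p' p &
        ae_eq_on Omega T' T].

(* [c] is the Poincare constant, [B] the stability bound. *)
Variables N1 N2 c B : R.

Definition L1_ : R :=
  r * m * Pr / 2 - (N1 + N2) * B - g * Pr * Ra * c ^+ 2.
Definition L2_ : R :=
  a / 2 - g * Pr * Ra * c ^+ 2 / 2 - 5 * N2 * B.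
Definition K1_ : R :=
  3 * r * m * Pr / 2 + 6 * (N1 * B) ^+ 2 / (r * m * Pr) + N2 * B.
Definition K2_ : R := 3 * r / (2 * m * Pr).
Definition K3_ : R := N2 * B + g * Pr * Ra * c ^+ 2 / 2 + a / 2.

End Problem.

(* Main.v *)
(** The constants may depend on everything but the mesh and the solutions, so the
    two bounds amount to a quasi-optimality estimate
    [|u - u_h| + |T - T_h| <= M (|u - v| + |T - S| + ||p - q||)] for all discrete
    [v], [S], [q].  Subtract the discrete equation from the continuous one and
    test with [v - u_h] and [S - T_h].  Without using any skew-symmetry, the
    convective terms are absorbed because [L1, L2 > 0]; the pressure error
    [p_h - q] is controlled through the inf-sup condition by the velocity and
    temperature errors, and it only occurs multiplied by [|u - v|], because
    [b(u, .)] and [b(u_h, .)] both vanish on the discrete pressures.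
    The trilinear forms are additive at the relevant arguments because a discrete
    test function, being piecewise polynomial, is bounded.

    Weak derivatives are chosen representatives, so that the linearity of
    [u |-> dx i u] up to null sets rests on the fundamental lemma of the calculus
    of variations: products of the flat functions [exp(-1/t)] are test functions
    whose dilations converge to indicators of rectangles.  That the closure of the
    test functions is stable under subtraction requires their classical
    derivatives to be weak ones, by Fubini's theorem. *)

Require Import Defs.
From HB Require Import structures.
From mathcomp Require Import all_boot all_order all_algebra.
From mathcomp Require Import all_classical all_reals all_analysis.
From mathcomp Require Import ring lra measurable_realfun.

Set Implicit Arguments.
Unset Strict Implicit.
Unset Printing Implicit Defensive.

Import Order.TTheory GRing.Theory Num.Theory.
Import numFieldNormedType.Exports.

Local Open Scope classical_set_scope.
Local Open Scope ring_scope.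

(** * Rectangles and measurability in the plane *)

Section PlaneMeasure.
Variable R : realType.
Notation RR := (measurableTypeR R * measurableTypeR R)%type.

(** The open and the closed rectangle share the parameter [q], which lists the endpoints of the two
    sides, so that [crect q] contained in [U] says that [rect q] has its closed version inside
    [U]. *)
Definition rect (q : R * R * (R * R)) : set (R * R) :=
  `]q.1.1, q.1.2[ `*` `]q.2.1, q.2.2[.

Definition crect (q : R * R * (R * R)) : set (R * R) :=
  `[q.1.1, q.1.2] `*` `[q.2.1, q.2.2].

Lemma measurable_rect q : measurable (rect q : set RR).
Proof. by apply: measurableX; exact: measurable_itv. Qed.

Definition qrect (q : rat * rat * (rat * rat)) : R * R * (R * R) :=
  ((ratr q.1.1, ratr q.1.2), (ratr q.2.1, ratr q.2.2)).

Lemma open_bigcup_rect (U : set (R * R)) : open U ->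
  U = \bigcup_(q in [set q | crect (qrect q) `<=` U]) rect (qrect q).
Proof.
move=> oU; apply/seteqP; split => [[x y] Uxy|x [q /= qU qx]]; last first.
  by apply: qU; case: qx => /= h1 h2; split => /=; apply: subset_itv_oo_cc.
have /nbhs_ballP[e /= e0 eU] := open_nbhs_nbhs (conj oU Uxy).
have rat_near (z : R) : exists a b : rat,
    [/\ z - e < ratr a, ratr a < z, z < ratr b & ratr b < z + e].
  have /rat_in_itvoo[a /itvP ha] : z - e < z by rewrite ltrBlDr ltrDl.
  have /rat_in_itvoo[b /itvP hb] : z < z + e by rewrite ltrDl.
  by exists a, b; rewrite !ha !hb.
have [a [b [a1 a2 b1 b2]]] := rat_near x.
have [c [d [c1 c2 d1 d2]]] := rat_near y.
exists ((a, b), (c, d)) => /=; last by split; rewrite /= in_itv /= ?a2 ?c2.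
move=> [s t] [/= +  +]; rewrite !in_itv /= => /andP[s1 s2] /andP[t1 t2].
apply: eU; split => /=; rewrite /ball /= ltr_distlC.
  by rewrite (lt_le_trans a1 s1) (le_lt_trans s2 b2).
by rewrite (lt_le_trans c1 t1) (le_lt_trans t2 d2).
Qed.

(** The rectangles with rational endpoints are countable. The closed rectangles are kept inside [U]
    because the bumps carried by [rect (F n)] have to be test functions of [U]. *)
Lemma open_rect_cover (U : set (R * R)) : open U ->
  exists2 F : nat -> R * R * (R * R),
    (forall n, crect (F n) `<=` U) & U = \bigcup_n rect (F n).
Proof.
(* [e] is an empty rectangle, the default for the indices that code no admissible one. *)
move=> oU; pose e : R * R * (R * R) := ((1, 0), (1, 0)).
pose F n := if unpickle n is Some q then
  if pselect (crect (qrect q) `<=` U) then qrect q else e else e.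
have eU : crect e `<=` U.
  move=> [x y] [/=]; rewrite in_itv /= => /andP[h1 h2].
  by have := le_trans h1 h2; rewrite ler10.
have FU n : crect (F n) `<=` U.
  by rewrite /F; case: unpickle => // q; case: pselect.
exists F => //; apply/seteqP; split => [x|x [n _ Fx]]; last first.
  by apply: (FU n); case: Fx => h1 h2; split; apply: subset_itv_oo_cc.
rewrite {1}(open_bigcup_rect oU) => -[q /= qU qx].
by exists (pickle q) => //; rewrite /F pickleK; case: pselect.
Qed.

(** Measurability refers to the product sigma-algebra, so open sets are measurable only through the
    countable cover by rectangles. *)
Lemma open_measurable2 (U : set (R * R)) : open U -> measurable (U : set RR).
Proof.
move=> /open_rect_cover[F _ ->]; apply: bigcupT_measurable => n.
exact: measurable_rect.
Qed.

Lemma continuous_measurable2 (f : R * R -> R) : continuous f ->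
  measurable_fun setT (f : RR -> R).
Proof.
move=> /continuousP cf; apply: (measurability _ (measurable_realfun.RGenOpens.measurableE R)).
move=> _ [_ [a [b ->] <-]]; rewrite setTI; apply: open_measurable2.
exact/cf/interval_open.
Qed.

Lemma bounded_box (A : set (R * R)) : bounded_set A ->
  exists2 M : R, 0 < M & A `<=` crect ((- M, M), (- M, M)).
Proof.
move=> [M [_ /(_ (`|M| + 1))]] /=.
rewrite (le_lt_trans (ler_norm M)) ?ltrDl // => /(_ isT) hM.
exists (`|M| + 1); first by rewrite ltr_wpDl.
move=> [x y] /hM /=; rewrite prod_normE /= ge_max => /andP[hx hy].
by split; rewrite /= in_itv /= -ler_norml.
Qed.

Lemma crect_finite q : (@leb2 R (crect q) < +oo)%E.
Proof.
have -> : @leb2 R (crect q) = (@lebesgue_measure R `[q.1.1, q.1.2]%classic *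
    @lebesgue_measure R `[q.2.1, q.2.2]%classic)%E.
  by apply: product_measure1E; exact: measurable_itv.
rewrite lte_mul_pinfty //; try exact: measure_ge0.
  by rewrite ge0_fin_numE // lebesgue_measure_itv /=; case: ifP; rewrite ?ltry.
by rewrite lebesgue_measure_itv /=; case: ifP; rewrite ?ltry.
Qed.

Lemma bounded_finite (A : set (R * R)) : measurable (A : set RR) ->
  bounded_set A -> (@leb2 R A < +oo)%E.
Proof.
move=> mA /bounded_box[M _ AM]; apply: le_lt_trans (crect_finite _).
  apply: le_measure; last exact: AM; rewrite inE //.
by apply: measurableX; exact: measurable_itv.
Qed.

(** Generators for a later Dynkin argument. The product sigma-algebra is generated by the preimages
    of open intervals under the two projections; these are open, hence countable unions of
    rectangles. *)
Lemma measurable_g_rect :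
  @measurable _ RR = <<s [set rect q | q in setT] >>.
Proof.
apply/seteqP; split; apply: smallest_sub; last 2 first.
- exact: sigma_algebra_measurable.
- by move=> _ [q _ <-]; exact: measurable_rect.
- exact: smallest_sigma_algebra.
have openG (U : set (R * R)) : open U -> <<s [set rect q | q in setT] >> U.
  move=> /open_rect_cover[F _ ->].
  apply: (@sigma_algebra_bigcup _ setT) => n; apply: sub_sigma_algebra.
  by exists (F n).
have itvE : @measurable _ (measurableTypeR R) =
    <<s @measurable_realfun.RGenOpens.G R >>.
  exact: measurable_realfun.RGenOpens.measurableE.
move=> X [|] [Y mY <-].
- suff : preimage_set_system setT (@fst R R) <<s @measurable_realfun.RGenOpens.G R >>
     `<=` <<s [set rect q | q in setT] >> by apply; exists Y => //; rewrite -itvE.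
  rewrite -g_sigma_preimageE; apply: smallest_sub.
    exact: smallest_sigma_algebra.
  move=> _ [_ [a [b ->]] <-]; rewrite setTI; apply: openG.
  apply: open_comp; last exact: interval_open.
  by move=> x _; exact: cvg_fst.
- suff : preimage_set_system setT (@snd R R) <<s @measurable_realfun.RGenOpens.G R >>
     `<=` <<s [set rect q | q in setT] >> by apply; exists Y => //; rewrite -itvE.
  rewrite -g_sigma_preimageE; apply: smallest_sub.
    exact: smallest_sigma_algebra.
  move=> _ [_ [a [b ->]] <-]; rewrite setTI; apply: openG.
  apply: open_comp; last exact: interval_open.
  by move=> x _; exact: cvg_snd.
Qed.

Lemma rectI p q : rect p `&` rect q =
  rect ((Num.max p.1.1 q.1.1, Num.min p.1.2 q.1.2),
        (Num.max p.2.1 q.2.1, Num.min p.2.2 q.2.2)).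
Proof.
apply/seteqP; split => -[x y]; rewrite /rect /= !in_itv /= !gt_max !lt_min.
  by move=> [[/andP[-> ->] /andP[-> ->]] [/andP[-> ->] /andP[-> ->]]].
by move=> [/andP[/andP[-> ->] /andP[-> ->]] /andP[/andP[-> ->] /andP[-> ->]]].
Qed.

End PlaneMeasure.

(** * Square-integrable functions *)

#[local] Instance leb2_ae_filter (R : realType) :
  Filter (nbhs (almost_everywhere (@leb2 R))).
Proof. exact: (ae_filter_ringOfSetsType (@leb2 R)). Qed.

Section L2Theory.
Variables (R : realType) (Omega : set (R * R)).
Notation RR := (measurableTypeR R * measurableTypeR R)%type.
Hypothesis mO : measurable (Omega : set RR).
Notation intO f := ((@leb2 R).-integrable Omega (EFin \o f)).
Implicit Types f g : R * R -> R.

Lemma integ_mkcond f : integ Omega f = \int[@leb2 R]_x (f \_ Omega) x.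
Proof. exact: Rintegral_mkcond. Qed.

Lemma integ_add f g : intO f -> intO g ->
  integ Omega (fun x => f x + g x) = integ Omega f + integ Omega g.
Proof. by move=> fi gi; rewrite /integ RintegralD. Qed.

Lemma integ_sub f g : intO f -> intO g ->
  integ Omega (fun x => f x - g x) = integ Omega f - integ Omega g.
Proof. by move=> fi gi; rewrite /integ RintegralB. Qed.

Lemma intO_add f g : intO f -> intO g -> intO (fun x => f x + g x).
Proof. by move=> fi gi; apply: (integrableD mO fi gi). Qed.

Lemma intO_sum (I : eqType) (s : seq I) (F : I -> R * R -> R) :
  (forall i, intO (F i)) -> intO (fun x => \sum_(i <- s) F i x).
Proof.
move=> Fi; have := @integrable_sum _ _ _ (@leb2 R) Omega mO I s xpredT
  (fun i => EFin \o F i) (fun i _ => Fi i).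
by apply: eq_integrable => // x _; rewrite /= sumEFin.
Qed.

Lemma integ_sum (I : eqType) (s : seq I) (F : I -> R * R -> R) :
  (forall i, intO (F i)) ->
  integ Omega (fun x => \sum_(i <- s) F i x) = \sum_(i <- s) integ Omega (F i).
Proof.
move=> Fi; elim: s => [|i s IH].
  rewrite big_nil /integ; under eq_Rintegral do rewrite big_nil.
  by rewrite Rintegral_cst // mul0r.
rewrite big_cons -IH -integ_add //; last exact: intO_sum.
by apply: eq_Rintegral => x _; rewrite big_cons.
Qed.

Lemma L2_measurable f : L2 Omega f -> measurable_fun Omega (f : RR -> R).
Proof.
rewrite /L2 /= inE => /andP[/[!inE] /= mf _].
by apply/(measurable_restrictT _ mO).
Qed.

Lemma L2_sqr f : L2 Omega f -> intO (fun x => f x ^+ 2).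
Proof.
move=> /Lfun2_integrable_sqr h; apply/(integrable_mkcond _ mO).
apply: eq_integrable h => // x _; rewrite /= !patchE.
by case: ifP => //; rewrite expr0n.
Qed.

Lemma L2_of_sqr f : measurable_fun Omega (f : RR -> R) ->
  intO (fun x => f x ^+ 2) -> L2 Omega f.
Proof.
move=> mf f2; rewrite /L2 /= inE; apply/andP; split.
  by rewrite inE; apply/(measurable_restrictT _ mO).
rewrite inE /= /finite_norm unlock; apply: poweR_lty.
have /integrableP[_] : (@leb2 R).-integrable setT (EFin \o (fun x => (f \_ Omega) x ^+ 2)).
  move/(integrable_mkcond _ mO): f2; apply: eq_integrable => // x _.
  by rewrite /= !patchE; case: ifP => //; rewrite expr0n.
congr (_ < _)%E; apply: eq_integral => x _ /=.
by rewrite powR_mulrn // normrX.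
Qed.

Lemma L2norm_ge0 f : 0 <= L2norm Omega f.
Proof. by rewrite /L2norm fine_ge0 // Lnorm_ge0. Qed.

Lemma L2norm_fin f : L2 Omega f ->
  (L2norm Omega f)%:E = ('N[@leb2 R]_2%:E[EFin \o (f \_ Omega)])%E.
Proof.
rewrite /L2 /= inE => /andP[_]; rewrite inE /= /finite_norm => h.
by rewrite /L2norm fineK // ge0_fin_numE // Lnorm_ge0.
Qed.

Lemma L2norm_sqr f : L2 Omega f ->
  L2norm Omega f ^+ 2 = integ Omega (fun x => f x ^+ 2).
Proof.
move=> fL; rewrite integ_mkcond /Rintegral.
have := powR_Lnorm (@leb2 R) (EFin \o (f \_ Omega)) (r := 2).
rewrite -L2norm_fin // pnatr_eq0 => /(_ isT) h.
rewrite -powR_mulrn ?L2norm_ge0 // -[LHS]/(fine _%:E); congr fine.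
rewrite -[LHS]/((L2norm Omega f)%:E `^ 2)%E h; apply: eq_integral => x _.
rewrite /= powR_mulrn // -normrX ger0_norm ?sqr_ge0 // !patchE.
by case: ifP => //; rewrite expr0n.
Qed.

Lemma L2norm_sqrt f : L2 Omega f ->
  L2norm Omega f = Num.sqrt (integ Omega (fun x => f x ^+ 2)).
Proof. by move=> /L2norm_sqr <-; rewrite sqrtr_sqr ger0_norm // L2norm_ge0. Qed.

Lemma intO_le f g : measurable_fun Omega (f : RR -> R) ->
  (forall x, Omega x -> `|f x| <= `|g x|) -> intO g -> intO f.
Proof.
move=> mf fg; apply: le_integrable => //; exact/measurable_EFinP.
Qed.

Lemma intO_scale k f : intO f -> intO (fun x => k * f x).
Proof. by move=> fi; apply: (integrableZl mO k fi). Qed.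

Lemma integ_scale k f : intO f ->
  integ Omega (fun x => k * f x) = k * integ Omega f.
Proof. by move=> fi; rewrite /integ RintegralZl. Qed.

Lemma integ_ge0 f : (forall x, Omega x -> 0 <= f x) -> 0 <= integ Omega f.
Proof. by move=> f0; apply: Rintegral_ge0. Qed.

Lemma L2_mul f g : L2 Omega f -> L2 Omega g -> intO (fun x => f x * g x).
Proof.
move=> fL gL; apply: (@intO_le _ (fun x => f x ^+ 2 + g x ^+ 2)).
- by apply: measurable_funM; exact: L2_measurable.
- move=> x _; rewrite normrM [leRHS]ger0_norm ?addr_ge0 ?sqr_ge0 //.
  rewrite -[f x ^+ 2]real_normK ?num_real // -[g x ^+ 2]real_normK ?num_real //.
  by have := sqr_ge0 (`|f x| - `|g x|); have := normr_ge0 (f x);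
     have := normr_ge0 (g x); nra.
- by apply: intO_add; exact: L2_sqr.
Qed.

Lemma L2_add f g : L2 Omega f -> L2 Omega g -> L2 Omega (f \+ g).
Proof.
move=> fL gL; apply: L2_of_sqr.
  by apply: measurable_funD; exact: L2_measurable.
have -> : (fun x => (f \+ g) x ^+ 2) =
    (fun x => (f x ^+ 2 + 2 * (f x * g x)) + g x ^+ 2).
  by apply/funext => x /=; ring.
apply: intO_add; last exact: L2_sqr.
by apply: intO_add; [exact: L2_sqr|exact/intO_scale/L2_mul].
Qed.

Lemma L2_scale k f : L2 Omega f -> L2 Omega (fun x => k * f x).
Proof.
move=> fL; apply: L2_of_sqr.
  by apply: measurable_funM => //; exact: L2_measurable.
rewrite (_ : (fun x => _) = (fun x => k ^+ 2 * f x ^+ 2)).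
  exact/intO_scale/L2_sqr.
by apply/funext => x; rewrite exprMn.
Qed.

Lemma L2_sub f g : L2 Omega f -> L2 Omega g -> L2 Omega (f \- g).
Proof.
move=> fL gL; rewrite (_ : f \- g = f \+ (fun x => -1 * g x)).
  by apply: L2_add => //; exact: L2_scale.
by apply/funext => x /=; rewrite mulN1r.
Qed.

Lemma L2_cst0 : L2 Omega (cst 0).
Proof.
apply: L2_of_sqr => //.
rewrite (_ : (fun x => _) = cst 0); first exact: integrable0.
by apply/funext => x; rewrite expr0n.
Qed.

Lemma CS_L2 f g : L2 Omega f -> L2 Omega g ->
  `|integ Omega (fun x => f x * g x)| <= L2norm Omega f * L2norm Omega g.
Proof.
move=> fL gL; set p := integ _ _; set F := L2norm _ f; set G := L2norm _ g.
(* The integral of [(t f + g)^2], a quadratic polynomial in [t]. *)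
have quad t : 0 <= t ^+ 2 * F ^+ 2 + t * (2 * p) + G ^+ 2.
  rewrite /F /G !L2norm_sqr // /p.
  rewrite -(integ_scale 2) ?L2_mul // -!integ_scale ?L2_sqr //;
    last by apply: intO_scale; exact: L2_mul.
  rewrite -!integ_add ?L2_sqr //; try apply: intO_add; try apply: intO_scale;
    try apply: intO_scale; try exact: L2_sqr; try exact: L2_mul.
  apply: integ_ge0 => x _.
  by have := sqr_ge0 (t * f x + g x); lra.
have F0 : 0 <= F by exact: L2norm_ge0.
have G0 : 0 <= G by exact: L2norm_ge0.
have pFG : p ^+ 2 <= (F * G) ^+ 2.
  have [F00|Fn0] := eqVneq F 0.
    have [->|pn0] := eqVneq p 0; first by rewrite F00 mul0r.
    (* For [F = 0] the polynomial is affine, and this [t] gives it the value [-1]. *)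
    have := quad (- (G ^+ 2 + 1) / (2 * p)); rewrite F00.
    rewrite divfK ?mulf_neq0 ?pnatr_eq0 // => h; exfalso; lra.
  have F20 : 0 < F ^+ 2 by rewrite exprn_gt0 // lt0r Fn0.
  (* The minimum of the quadratic polynomial. *)
  have := quad (- p / F ^+ 2).
  have -> : (- p / F ^+ 2) ^+ 2 * F ^+ 2 + - p / F ^+ 2 * (2 * p) + G ^+ 2 =
     ((F * G) ^+ 2 - p ^+ 2) / F ^+ 2 by field.
  by rewrite pmulr_lge0 ?invr_gt0 // subr_ge0.
by rewrite -(ler_sqr (normr_ge0 _)) ?nnegrE ?mulr_ge0 // real_normK // num_real.
Qed.

Lemma L2norm_add f g : L2 Omega f -> L2 Omega g ->
  L2norm Omega (f \+ g) <= L2norm Omega f + L2norm Omega g.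
Proof.
move=> fL gL; rewrite -ler_sqr ?nnegrE ?addr_ge0 ?L2norm_ge0 //.
rewrite L2norm_sqr; last exact: L2_add.
have -> : (fun x => (f \+ g) x ^+ 2) =
    (fun x => (f x ^+ 2 + 2 * (f x * g x)) + g x ^+ 2).
  by apply/funext => x /=; ring.
rewrite integ_add; last exact: L2_sqr.
  rewrite integ_add; [|exact: L2_sqr|exact/intO_scale/L2_mul].
  rewrite integ_scale -?L2norm_sqr //; last exact: L2_mul.
  by have := CS_L2 fL gL; have := ler_norm (integ Omega (fun x => f x * g x)); lra.
by apply: intO_add; [exact: L2_sqr|exact/intO_scale/L2_mul].
Qed.

Lemma L2norm_scale k f : L2 Omega f ->
  L2norm Omega (fun x => k * f x) = `|k| * L2norm Omega f.
Proof.
move=> fL; rewrite !L2norm_sqrt //; last exact: L2_scale.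
under [in LHS]eq_fun do rewrite exprMn.
by rewrite integ_scale ?L2_sqr // sqrtrM ?sqr_ge0 // sqrtr_sqr.
Qed.

Lemma ae_integ f g : measurable_fun Omega (f : RR -> R) ->
  measurable_fun Omega (g : RR -> R) -> ae_eq_on Omega f g ->
  integ Omega f = integ Omega g.
Proof.
move=> mf mg fg; congr fine; apply: ae_eq_integral => //.
- exact/measurable_EFinP.
- exact/measurable_EFinP.
- by apply: filterS fg => x /= h /h ->.
Qed.

Lemma ae_L2norm f g : L2 Omega f -> L2 Omega g -> ae_eq_on Omega f g ->
  L2norm Omega f = L2norm Omega g.
Proof.
move=> fL gL fg; rewrite !L2norm_sqrt //; congr Num.sqrt; apply: ae_integ.
- by case/integrableP: (L2_sqr fL) => /measurable_EFinP.
- by case/integrableP: (L2_sqr gL) => /measurable_EFinP.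
- by apply: filterS fg => x h /h ->.
Qed.

Lemma ae_intO f g : measurable_fun Omega (f : RR -> R) -> ae_eq_on Omega f g ->
  intO g -> intO f.
Proof.
move=> mf fg gi; apply/integrableP; split; first exact/measurable_EFinP.
case/integrableP: gi => mg; congr (_ < _)%E; apply: ae_eq_integral => //.
- exact: measurableT_comp.
- by apply: measurableT_comp => //; exact/measurable_EFinP.
- by apply: filterS fg => x h /h /= ->.
Qed.

Lemma L2_bounded_mul (M : R) f g : measurable_fun Omega (f : RR -> R) ->
  {ae @leb2 R, forall x, Omega x -> `|f x| <= M} -> L2 Omega g ->
  L2 Omega (fun x => f x * g x).
Proof.
move=> mf fM gL; have mg := L2_measurable gL.
have mfg : measurable_fun Omega ((fun x => f x * g x) : RR -> R).
  exact: measurable_funM.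
apply: L2_of_sqr => //.
(* The bound on [f] holds almost everywhere only. The truncation [f'] is bounded everywhere and
   agrees with [f] off a null set of [Omega]. *)
pose f' (x : R * R) : R := Num.max (- `|M|) (Num.min `|M| (f x)).
have f'M x : `|f' x| <= `|M|.
  by rewrite ler_norml /f' le_max lexx /= ge_max ge_min lexx /= ge0_cp.
have mf' : measurable_fun Omega (f' : RR -> R).
  by apply: measurable_maxr => //; exact: measurable_minr.
apply: (@ae_intO _ (fun x => (f' x * g x) ^+ 2)).
- exact: measurable_funX.
- apply: filterS fM => x h /h /le_trans/(_ (ler_norm M)).
  by rewrite ler_norml => /andP[h1 h2]; rewrite /f' (min_r h2) (max_r h1).
- apply: (@intO_le _ (fun x => M ^+ 2 * g x ^+ 2)); last exact/intO_scale/L2_sqr.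
    by apply: measurable_funX; exact: measurable_funM.
  move=> x _; have sq_ge0 (a b : R) : 0 <= a ^+ 2 * b ^+ 2.
    exact: mulr_ge0 (sqr_ge0 _) (sqr_ge0 _).
  rewrite exprMn !ger0_norm //; apply: ler_wpM2r; first exact: sqr_ge0.
  by rewrite -real_normK ?num_real // -[leRHS]real_normK ?num_real // ler_sqr.
Qed.
End L2Theory.

(** * Smooth bumps *)

Section FlatFunctions.
Variable R : realType.
Implicit Types (t : R) (n : nat).

(** The powers of [1/t] make the span of this family stable under differentiation, so that all the
    derivatives of [exp(-1/t)] are treated at once. *)
Definition flat n t : R := if 0 < t then t^-1 ^+ n * expR (- t^-1) else 0.

Lemma flat_pos n t : 0 < t -> flat n t = t^-1 ^+ n * expR (- t^-1).
Proof. by rewrite /flat => ->. Qed.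

Lemma flat_npos n t : t <= 0 -> flat n t = 0.
Proof. by rewrite /flat leNgt; case: ifP. Qed.

Lemma flat_ge0 n t : 0 <= flat n t.
Proof.
rewrite /flat; case: ifP => // t0.
by rewrite mulr_ge0 ?expR_ge0 // exprn_ge0 // invr_ge0 ltW.
Qed.

Lemma flat_div n t : t^-1 * flat n t = flat n.+1 t.
Proof. by rewrite /flat; case: ifP; rewrite ?mulr0 // exprS mulrA. Qed.

(** The exponential dominates the term of order [n + 1] of its series. The linear bound serves for
    differentiability at the origin. *)
Lemma flat_le n t : flat n t <= `|t| * n.+1`!%:R.
Proof.
have [t0|t0] := ltP 0 t; last first.
  by rewrite flat_npos // mulr_ge0.
rewrite flat_pos // gtr0_norm // expRN.
have ti : 0 < t^-1 by rewrite invr_gt0.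
have := expR_ge1Dxn n (ltW ti); set E := expR _ => hE.
have E0 : 0 < E by exact: expR_gt0.
have F0 : (0 : R) < n.+1`!%:R by rewrite ltr0n fact_gt0.
rewrite ler_pdivrMr // -(ler_pM2l ti) mulrA -exprS.
have : t^-1 ^+ n.+1 / n.+1`!%:R <= E by apply: le_trans hE; rewrite lerDr.
rewrite ler_pdivrMr // => /le_trans; apply.
by rewrite !mulrA mulVf ?gt_eqF // mul1r mulrC.
Qed.

Lemma is_derive_flat n t :
  is_derive t 1 (flat n) (flat n.+2 t - n%:R * flat n.+1 t).
Proof.
have [t0|t0|->] := ltgtP t 0.
- rewrite !flat_npos ?ltW // mulr0 subr0.
  apply: (@near_eq_is_derive _ _ _ (cst 0)).
  near=> s; rewrite flat_npos // ltW //; near: s; exact: lt_nbhsl.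
- rewrite !flat_pos //.
  have E : ((fun s : R => s^-1) ^+ n : R -> R) * (expR \o (fun s : R => - s^-1))
      = (fun s => s^-1 ^+ n * expR (- s^-1)) by rewrite exprfctE.
  apply: (@near_eq_is_derive _ _ _ (fun s : R => s^-1 ^+ n * expR (- s^-1) : R)).
    by near=> s; rewrite flat_pos //; near: s; exact: lt_nbhsr.
  rewrite -E.
  have dV : is_derive t 1 (fun s : R => s^-1) (- t ^- 2).
    have <- : - t ^- 2 *: 1 = - t ^- 2 by rewrite [_%:A]mulr1.
    by apply: (@is_deriveV R id); rewrite ?gt_eqF.
  have dE : is_derive t 1 (expR \o (fun s : R => - s^-1))
      (expR (- t^-1) * - (- t ^- 2)) by apply: is_derive1_comp.
  apply: is_derive_eq.
  rewrite exprfctE /= opprK -exprVn.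
  rewrite -![_ *: _]/(_ * _).
  by case: n {E} => [|m]; rewrite /= !exprS ?expr0; ring.
- rewrite !flat_npos // mulr0 subr0.
  (* At the origin the difference quotient is [flat n.+1 h], bounded by a multiple of [|h|]. *)
  suff h : h^-1 *: (flat n (h *: 1 + 0) - flat n 0) @[h --> (0:R)^'] --> (0:R).
    by apply: DeriveDef; [apply/cvg_ex; exists 0|exact: cvg_lim].
  apply/cvgr0Pnorm_le => e e0.
  near=> h; rewrite addr0 [_ *: 1]mulr1 (flat_npos n (lexx 0)) subr0.
  rewrite [_ *: _]flat_div ger0_norm ?flat_ge0 //.
  apply: le_trans (flat_le _ _) _; rewrite -ler_pdivlMr ?ltr0n ?fact_gt0 //.
  near: h; apply: dnbhs0_le; rewrite divr_gt0 // ltr0n fact_gt0 //.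
Unshelve. all: by end_near. Qed.

Lemma continuous_flat n : continuous (flat n).
Proof.
move=> t; apply: differentiable_continuous; apply/derivable1_diffP.
by have [] := is_derive_flat n t.
Qed.

Lemma flat0_cvg t :
  flat 0 (k.+1%:R * t) @[k --> \oo] --> (if 0 < t then 1 else 0 : R).
Proof.
case: ltP => t0; last first.
  rewrite (_ : (fun k => _) = cst (0 : R)); first exact: cvg_cst.
  by apply/funext => k; rewrite flat_npos // mulr_ge0_le0.
rewrite (_ : (fun k => _) = (fun k => expR (- (harmonic k * t^-1)))); last first.
  by apply/funext => k; rewrite flat_pos ?mulr_gt0 // expr0 mul1r invfM.
have h : - (harmonic k * t^-1) @[k --> \oo] --> (0 : R).
  rewrite -oppr0 -(mul0r t^-1); apply: cvgN; apply: cvgM; last exact: cvg_cst.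
  exact: cvg_harmonic.
by have := cvg_comp _ _ h (@continuous_expR R 0); rewrite expR0.
Qed.

Lemma flat0_le1 t : flat 0 t <= 1.
Proof.
rewrite /flat; case: ifP => // t0; rewrite expr0 mul1r.
by rewrite expR_le1 oppr_le0 invr_ge0 ltW.
Qed.

Lemma flat0_neq0 t : (flat 0 t != 0) = (0 < t).
Proof.
by rewrite /flat; case: ifP; rewrite ?eqxx // expr0 mul1r gt_eqF // expR_gt0.
Qed.
End FlatFunctions.

(** * Smooth bumps carried by rectangles *)

Section SmoothPlane.
Variable R : realType.
Implicit Types (x : R * R) (f g : R * R -> R) (i : 'I_2).

Lemma is_derive_slice f x i df :
  is_derive (0 : R) 1 (fun h : R => f (h *: e_ R i + x)) df ->
  is_derive x (e_ R i) f df.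
Proof.
have E : (fun h : R => h^-1 *: (f (h *: e_ R i + x) - f x)) =
  (fun h : R => h^-1 *: (f ((h *: 1 + 0) *: e_ R i + x) - f (0 *: e_ R i + x))).
  by apply/funext => h; rewrite addr0 scale0r add0r [h *: 1]mulr1.
move=> [d1 d2]; apply: DeriveDef.
  by move: d1; rewrite /derivable /= -E.
by move: d2; rewrite /derive /= -E.
Qed.

(* The closure under partial differentiation of the products of flat functions
   used below: smoothness becomes an induction on its members. *)
Inductive flatly : (R * R -> R) -> Prop :=
| flatly_flat n a b c : flatly (fun x => flat n (a * x.1 + b * x.2 + c))
| flatly_scale k f : flatly f -> flatly (fun x => k * f x)
| flatly_add f g : flatly f -> flatly g -> flatly (fun x => f x + g x)
| flatly_mul f g : flatly f -> flatly g -> flatly (fun x => f x * g x).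

Lemma flatly_continuous f : flatly f -> continuous f.
Proof.
elim=> {f} [n a b c|k f _ IH|f g _ IH1 _ IH2|f g _ IH1 _ IH2] x.
- apply: (@continuous_comp _ _ _ (fun x : R * R => a * x.1 + b * x.2 + c)
    (flat n)); last exact: continuous_flat.
  apply: cvgD; last exact: cvg_cst.
  by apply: cvgD; apply: cvgM; (try exact: cvg_cst); [exact: cvg_fst|exact: cvg_snd].
- by apply: cvgM; [exact: cvg_cst|exact: IH].
- by apply: cvgD; [exact: IH1|exact: IH2].
- by apply: cvgM; [exact: IH1|exact: IH2].
Qed.

Lemma flatly_derive f i : flatly f ->
  exists2 g, flatly g & forall x, is_derive x (e_ R i) f (g x).
Proof.
elim=> {f} [n a b c|k f _ [f' ff df]|f g _ [f' ff df] _ [g' gf dg]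
           |f g flf [f' ff df] flg [g' gf dg]].
(* [s] is the slope of the affine form in the direction [i]; the rest is the chain rule. *)
- pose s := a * (e_ R i).1 + b * (e_ R i).2.
  exists (fun x => s * (flat n.+2 (a * x.1 + b * x.2 + c) +
      (- n%:R) * flat n.+1 (a * x.1 + b * x.2 + c))).
    by do !constructor.
  move=> x; apply: is_derive_slice.
  pose t := a * x.1 + b * x.2 + c.
  have -> : (fun h : R => flat n (a * (h *: e_ R i + x).1 + b * (h *: e_ R i + x).2 + c))
     = flat n \o (fun h : R => s * h + t).
    apply/funext => h; rewrite [RHS]/= /s /t; congr flat.
    have -> : (h *: e_ R i + x).1 = h * (e_ R i).1 + x.1 by [].
    have -> : (h *: e_ R i + x).2 = h * (e_ R i).2 + x.2 by [].
    ring.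
  have dA : is_derive (0 : R) 1 (fun h : R => s * h + t) s.
    have d1 := is_deriveZ s (is_derive_id (0 : R) 1).
    have := is_deriveD d1 (is_derive_cst t (0 : R) 1).
    by rewrite addr0 [s *: 1]mulr1.
  rewrite mulrC mulNr; apply: is_derive1_comp; rewrite mulr0 add0r.
  exact: is_derive_flat.
- by exists (fun x => k * f' x); [constructor|move=> x; exact: is_deriveZ].
- exists (fun x => f' x + g' x); first by constructor.
  by move=> x; exact: is_deriveD.
- exists (fun x => f x * g' x + g x * f' x).
    by constructor; constructor.
  by move=> x; exact: is_deriveM.
Qed.

Lemma flatly_iterD f s : flatly f -> flatly (Defs.iterD s f).
Proof.
move=> ff; elim: s => [//|i s IH] /=.
have [g fg dg] := flatly_derive i IH.
suff -> : 'D_(e_ R i) (Defs.iterD s f) = g by [].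
by apply/funext => x; have [] := dg x.
Qed.

Lemma flatly_smooth f : flatly f -> smooth f.
Proof.
move=> ff s; split; first exact/flatly_continuous/flatly_iterD.
move=> i x; have [g _ /(_ x)[]//] := flatly_derive i (flatly_iterD s ff).
Qed.

(** Each factor switches the function off across one side of the rectangle. The bump is nonzero
    exactly on [rect q] for every [k], and steepens to the indicator as [k] grows. *)
Definition bump (q : R * R * (R * R)) (k : nat) x : R :=
  flat 0 (k.+1%:R * (x.1 - q.1.1)) * flat 0 (k.+1%:R * (q.1.2 - x.1)) *
  (flat 0 (k.+1%:R * (x.2 - q.2.1)) * flat 0 (k.+1%:R * (q.2.2 - x.2))).

Lemma bump_flatly q k : flatly (bump q k).
Proof.
have h1 a b : flatly (fun x => flat 0 (k.+1%:R * (a * x.1 + b))).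
  have := flatly_flat 0 (k.+1%:R * a) 0 (k.+1%:R * b).
  by congr flatly; apply/funext => x; congr flat; ring.
have h2 a b : flatly (fun x => flat 0 (k.+1%:R * (a * x.2 + b))).
  have := flatly_flat 0 0 (k.+1%:R * a) (k.+1%:R * b).
  by congr flatly; apply/funext => x; congr flat; ring.
apply: flatly_mul; apply: flatly_mul.
- by have := h1 1 (- q.1.1); congr flatly; apply/funext => x; rewrite mul1r.
- by have := h1 (-1) (q.1.2); congr flatly; apply/funext => x; rewrite mulN1r addrC.
- by have := h2 1 (- q.2.1); congr flatly; apply/funext => x; rewrite mul1r.
- by have := h2 (-1) (q.2.2); congr flatly; apply/funext => x; rewrite mulN1r addrC.
Qed.

Lemma bump_neq0 q k x : (bump q k x != 0) = (x \in rect q).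
Proof.
rewrite /bump !mulf_eq0 !negb_or !flat0_neq0 !pmulr_rgt0 // !subr_gt0.
apply/idP/idP; rewrite inE /rect /= !in_itv /=.
  by move=> /andP[/andP[-> ->] /andP[-> ->]].
by move=> [/andP[-> ->] /andP[-> ->]].
Qed.

Lemma bump_cvg q x : bump q k x @[k --> \oo] --> (\1_(rect q) x : R).
Proof.
have := flat0_cvg.
rewrite indicE; have -> : ((x \in rect q)%:R : R) =
  (if 0 < x.1 - q.1.1 then 1 else 0) * (if 0 < q.1.2 - x.1 then 1 else 0) *
  ((if 0 < x.2 - q.2.1 then 1 else 0) * (if 0 < q.2.2 - x.2 then 1 else 0)).
  rewrite -(bump_neq0 q 0) /bump !mulf_eq0 !negb_or !flat0_neq0 !pmulr_rgt0 //.
  by rewrite -!mulnb !natrM !mulrb.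
by move=> h; apply: cvgM; apply: cvgM; exact: h.
Qed.

Lemma bump_le1 q k x : `|bump q k x| <= 1.
Proof.
rewrite ger0_norm /bump; last first.
  by do ![apply: mulr_ge0 | exact: flat_ge0].
by do ![apply: mulr_ile1 | apply: mulr_ge0 | exact: flat_ge0 | exact: flat0_le1].
Qed.

Lemma bump_test Omega q k : crect q `<=` Omega -> test_function Omega (bump q k).
Proof.
move=> qO; have cq : compact (crect q).
  by apply: compact_setX; exact: segment_compact.
have clq : closure [set x | bump q k x != 0] `<=` crect q.
  have /closure_id -> : closed (crect q).
    by apply: compact_closed => //; exact: norm_hausdorff.
  apply: closureS => x /=; rewrite bump_neq0 inE => -[h1 h2].
  by split; apply: subset_itv_oo_cc.
split; first exact/flatly_smooth/bump_flatly.
- apply: subclosed_compact clq => //; exact: closed_closure.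
- exact: subset_trans clq qO.
Qed.
End SmoothPlane.

(** * The fundamental lemma of the calculus of variations *)

Section FundamentalLemma.
Variables (R : realType) (Omega : set (R * R)).
Notation RR := (measurableTypeR R * measurableTypeR R)%type.
Notation mu := (@leb2 R).
Hypothesis oO : open Omega.
Variable g : R * R -> R.
Hypothesis gi : mu.-integrable Omega (EFin \o g).
Hypothesis g0 : forall phi, test_function Omega phi ->
  integ Omega (fun x => g x * phi x) = 0.

Let mO : measurable (Omega : set RR) := open_measurable2 oO.

Let mg : measurable_fun Omega (g : RR -> R).
Proof. by case/integrableP: gi => /measurable_EFinP. Qed.

(** Dominated convergence: the integrals of [g] against the bumps vanish and the bumps tend to the
    indicator of [rect q], with [|g|] as dominating function. *)
Lemma rect_integral0 q : crect q `<=` Omega ->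
  (\int[mu]_(x in rect q) (g x)%:E = 0)%E.
Proof.
move=> qO; have rO : rect q `<=` Omega.
  by move=> x [h1 h2]; apply: qO; split; apply: subset_itv_oo_cc.
have mb k : measurable_fun Omega (bump q k : RR -> R).
  apply: measurable_funTS; apply: continuous_measurable2.
  exact/flatly_continuous/bump_flatly.
have mi : measurable_fun Omega (\1_(rect q) : RR -> R).
  by apply: measurable_indic; exact: measurable_rect.
pose f_ k x : \bar R := (g x * bump q k x)%:E.
pose f x : \bar R := (g x * \1_(rect q) x)%:E.
have mf k : measurable_fun Omega (f_ k : RR -> \bar R).
  by apply/measurable_EFinP; exact: measurable_funM.
have [||||_ _ h] := @dominated_convergence _ _ _ mu Omega mO f_ f
  (fun x => `|g x|%:E) mf.
- by apply/measurable_EFinP; exact: measurable_funM.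
- apply: aeW => x _; apply: cvg_EFin; first exact: nearW.
  by apply: cvgM; [exact: cvg_cst|exact: bump_cvg].
- exact: integrable_norm.
- apply: aeW => x k _; rewrite lee_fin normrM -[leRHS]mulr1.
  by apply: ler_wpM2l => //; exact: bump_le1.
have fk k : (\int[mu]_(x in Omega) f_ k x = 0)%E.
  have fi : mu.-integrable Omega (f_ k).
    apply: (intO_le mO _ _ gi); first exact: measurable_funM.
    move=> x _; rewrite normrM -[leRHS]mulr1.
    by apply: ler_wpM2l => //; exact: bump_le1.
  have := g0 (bump_test k qO); rewrite /integ /Rintegral => gk.
  by rewrite -[LHS]fineK ?gk // (integrable_fin_num mO fi).
have {h} : (\int[mu]_(x in Omega) f x = 0)%E.
  apply: (cvg_unique (@ereal_hausdorff R) h).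
  rewrite (_ : [sequence _]_k = cst 0%E); first exact: cvg_cst.
  by apply/funext.
rewrite integral_mkcond => h; rewrite integral_mkcond -[RHS]h.
apply: eq_integral => x _; rewrite !patchE /f indicE.
case: ifPn => xr; last by rewrite mulr0; case: ifP.
by rewrite mulr1 ifT // inE; apply: rO; rewrite -inE.
Qed.

(** The sets [A] such that [g] has integral zero over [rect q] intersected with [A] form a Dynkin
    system. It contains the rectangles, which are stable under intersection, hence every measurable
    set. *)
Lemma rect_ae0 q : crect q `<=` Omega -> ae_eq_on (rect q) g (cst 0).
Proof.
move=> qO; have rO : rect q `<=` Omega.
  by move=> x [h1 h2]; apply: qO; split; apply: subset_itv_oo_cc.
have mq := measurable_rect q.
have giA (A : set RR) : measurable A -> A `<=` rect q ->
    mu.-integrable A (EFin \o g).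
  by move=> mA Aq; apply: integrableS gi => //; exact: subset_trans rO.
have PI (A : set RR) : measurable A ->
    (\int[mu]_(x in rect q `&` A) (g x)%:E = 0)%E.
  rewrite measurable_g_rect; move: A; apply: dynkin_induction.
  - exact: measurable_g_rect.
  - by move=> _ _ [p _ <-] [p' _ <-]; rewrite rectI; eexists.
  - by rewrite setIT; exact: rect_integral0.
  - move=> _ [p _ <-]; rewrite rectI; apply: rect_integral0.
    move=> x /= [h1 h2]; apply: qO.
    move: h1 h2; rewrite /crect /= !in_itv /= !ge_max !le_min.
    by move=> /andP[/andP[-> _] /andP[-> _]] /andP[/andP[-> _] /andP[-> _]].
  (* Complements: the integrals over the two pieces add up to the integral over [rect q]. *)
  - move=> A mA A0.
    have : (\int[mu]_(x in (rect q `&` A) `|` (rect q `&` ~` A)) (g x)%:E = 0)%E.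
      by rewrite -setIUr setUv setIT; exact: rect_integral0.
    rewrite integral_setU.
    + by rewrite A0 add0e.
    + exact: measurableI.
    + by apply: measurableI => //; exact: measurableC.
    + rewrite -setIUr setUv setIT; apply/measurable_EFinP.
      exact: measurable_funS mg.
    + apply/disj_setPLR => x [_ Ax] [_]; exact.
  - move=> F mF tF F0; rewrite setI_bigcupr integral_bigcup.
    + by rewrite eseries0 // => i _ _; exact: F0.
    + exact: trivIset_setIl.
    + by move=> k; exact: measurableI.
    + apply: giA; first by apply: bigcupT_measurable => k; exact: measurableI.
      by move=> x [k _ []].
have : ae_eq mu (rect q) (EFin \o g) (EFin \o cst 0).
  apply: (integral_ae_eq mq); [exact: giA|exact: (measurable_cst (0%:E : \bar R))|].
  move=> E Eq mE; have := PI E mE; rewrite setIidr // => ->.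
  by under eq_integral do rewrite /=; rewrite integral0.
by apply: filterS => x h /h [].
Qed.

(** Countably many rectangles cover [Omega], so the exceptional sets form a null set. *)
Lemma fundamental_lemma : ae_eq_on Omega g (cst 0).
Proof.
have [F FO OE] := open_rect_cover oO.
rewrite /ae_eq_on.
have : mu.-negligible (\bigcup_n ~` [set x | rect (F n) x -> g x = 0]).
  by apply: negligible_bigcup => n; exact: rect_ae0.
apply: negligibleS => x /= /not_implyP[].
rewrite {1}OE => -[n _ Fx] gx; exists n => // h; exact/gx/h.
Qed.
End FundamentalLemma.

(** * Weak derivatives *)

Section SqrtSums.
Variable R : realType.
Implicit Types a b c d : R.

Lemma sqrtD2_ge0 a b : 0 <= a ^+ 2 + b ^+ 2.
Proof. by rewrite addr_ge0 ?sqr_ge0. Qed.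

Lemma sqrtD2_mono a b c d : 0 <= a -> a <= b -> 0 <= c -> c <= d ->
  Num.sqrt (a ^+ 2 + c ^+ 2) <= Num.sqrt (b ^+ 2 + d ^+ 2).
Proof.
move=> a0 ab c0 cd; rewrite ler_wsqrtr // lerD // ler_sqr ?nnegrE //.
  exact: le_trans ab.
exact: le_trans cd.
Qed.

Lemma cauchy2 a b c d :
  a * b + c * d <= Num.sqrt (a ^+ 2 + c ^+ 2) * Num.sqrt (b ^+ 2 + d ^+ 2).
Proof.
apply: le_trans (ler_norm _) _; rewrite -sqrtrM ?sqrtD2_ge0 // -sqrtr_sqr.
(* Lagrange's identity. *)
by apply: ler_wsqrtr; have := sqr_ge0 (a * d - b * c); nra.
Qed.

Lemma sqrtD2_triangle a b c d :
  Num.sqrt ((a + b) ^+ 2 + (c + d) ^+ 2) <=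
  Num.sqrt (a ^+ 2 + c ^+ 2) + Num.sqrt (b ^+ 2 + d ^+ 2).
Proof.
rewrite -ler_sqr ?nnegrE ?addr_ge0 ?sqrtr_ge0 // sqr_sqrtr ?sqrtD2_ge0 //.
rewrite [leRHS]sqrrD !sqr_sqrtr ?sqrtD2_ge0 //.
by have := cauchy2 a b c d; lra.
Qed.
End SqrtSums.

Lemma sum_ord2 (V : nmodType) (F : 'I_2 -> V) : \sum_i F i = F 0 + F 1.
Proof. by rewrite big_ord_recl big_ord1; congr (_ + F _); exact: val_inj. Qed.

Section WeakDerivatives.
Variables (R : realType) (Omega : set (R * R)).
Notation RR := (measurableTypeR R * measurableTypeR R)%type.
Notation mu := (@leb2 R).
Hypotheses (oO : open Omega) (bO : bounded_set Omega).
Notation intO f := (mu.-integrable Omega (EFin \o f)).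
Notation D := Defs.iterD.
Implicit Types (u v f g phi psi : R * R -> R) (s : seq 'I_2) (i : 'I_2).

Let mO : measurable (Omega : set RR) := open_measurable2 oO.

Lemma L2_cst1 : L2 Omega (cst 1).
Proof.
apply: L2_of_sqr => //.
rewrite (_ : (fun x => _) = cst 1); last first.
  by apply/funext => x; rewrite expr1n.
apply/integrableP; split.
  exact: (measurable_cst (1%:E : \bar R)).
rewrite (eq_integral (cst 1%E)); last by move=> x _; rewrite /= normr1.
by rewrite integral_cst // mul1e; exact: bounded_finite.
Qed.

(** The bounded set [Omega] has finite measure, so the constant [1] is square-integrable and can be
    paired with [f]. *)
Lemma L2_integrable f : L2 Omega f -> intO f.
Proof.
move=> fL; have := L2_mul mO fL L2_cst1.
by apply: eq_integrable => // x _; rewrite /= mulr1.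
Qed.

Lemma continuous_bounded f : continuous f ->
  exists2 M : R, 0 <= M & forall x, Omega x -> `|f x| <= M.
Proof.
move=> cf; have [M _ OM] := bounded_box bO.
have cB : compact (f @` crect ((- M, M), (- M, M))).
  apply: continuous_compact; first exact: continuous_subspaceT.
  by apply: compact_setX; exact: segment_compact.
have [N [_ /(_ (`|N| + 1))]] := compact_bounded cB.
rewrite (le_lt_trans (ler_norm N)) ?ltrDl // => /(_ isT) hN.
exists (`|N| + 1); first by rewrite addr_ge0.
by move=> x /OM Mx; apply: hN; exists x.
Qed.

Lemma continuous_L2 f : continuous f -> L2 Omega f.
Proof.
move=> cf; have [M _ fM] := continuous_bounded cf.
have := L2_bounded_mul mO (measurable_funTS (continuous_measurable2 cf))
  (aeW mu fM) L2_cst1.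
by congr L2; apply/funext => x; rewrite mulr1.
Qed.

Lemma test_continuous s phi : test_function Omega phi -> continuous (D s phi).
Proof. by move=> [/(_ s)[]]. Qed.

Lemma test_L2 s phi : test_function Omega phi -> L2 Omega (D s phi).
Proof. by move=> /(@test_continuous s); exact: continuous_L2. Qed.

Lemma iterD_sub s phi psi : smooth phi -> smooth psi ->
  D s (phi \- psi) = D s phi \- D s psi.
Proof.
move=> sphi spsi; elim: s => [//|i s IH] /=; rewrite IH.
apply/funext => x; apply: deriveB; first by have [_] := sphi s; exact.
by have [_] := spsi s; exact.
Qed.

Lemma test_sub phi psi : test_function Omega phi -> test_function Omega psi ->
  test_function Omega (phi \- psi).
Proof.
move=> [sphi cphi Ophi] [spsi cpsi Opsi].
have sub : closure [set x | (phi \- psi) x != 0] `<=`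
    closure [set x | phi x != 0] `|` closure [set x | psi x != 0].
  rewrite -closureU; apply: closureS => x /=; apply: contraPP => /not_orP[].
  by move=> /negP/negbNE/eqP -> /negP/negbNE/eqP ->; rewrite subrr eqxx.
split.
- move=> s; rewrite iterD_sub //; have [c1 d1] := sphi s.
  have [c2 d2] := spsi s; split; first by move=> x; apply: cvgB; [exact: c1|exact: c2].
  by move=> i x; apply: derivableB; [exact: d1|exact: d2].
- apply: subclosed_compact sub; first exact: closed_closure.
  exact: compactU.
- by apply: subset_trans sub _; rewrite subUset.
Qed.

(** The difference [g1 - g2] is integrable and orthogonal to all test functions. *)
Lemma is_wderiv_unique s u g1 g2 : is_wderiv Omega s u g1 ->
  is_wderiv Omega s u g2 -> ae_eq_on Omega g1 g2.
Proof.
move=> [L1 h1] [L2 h2].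
have : ae_eq_on Omega (fun x => g1 x - g2 x) (cst 0).
  apply: (fundamental_lemma oO).
    by apply: L2_integrable; exact: L2_sub.
  move=> phi tphi; have pL : Defs.L2 Omega phi := @test_L2 [::] phi tphi.
  have -> : (fun x => (g1 x - g2 x) * phi x) =
      (fun x => g1 x * phi x - g2 x * phi x).
    by apply/funext => x; rewrite mulrBl.
  rewrite integ_sub //; try exact: L2_mul.
  have := h1 _ tphi; rewrite h2 // => /(mulfI _) ->; first by rewrite subrr.
  by rewrite signr_eq0.
by apply: filterS => x h /h /eqP; rewrite subr_eq0 => /eqP.
Qed.

Lemma wderivP s u : (exists g, is_wderiv Omega s u g) ->
  is_wderiv Omega s u (wderiv Omega s u).
Proof. exact: xgetPex. Qed.

(** When [u] has no weak derivative, the conventional value is the null function, which is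
    square-integrable as well. *)
Lemma wderiv_L2 s u : L2 Omega (wderiv Omega s u).
Proof.
rewrite /wderiv; case: xgetP => [g _ [] //|_]; exact: L2_cst0.
Qed.

Lemma dx_L2 i u : L2 Omega (dx Omega i u).
Proof. exact: wderiv_L2. Qed.

Lemma is_wderiv_sub s u v gu gv : L2 Omega u -> L2 Omega v ->
  is_wderiv Omega s u gu -> is_wderiv Omega s v gv ->
  is_wderiv Omega s (u \- v) (gu \- gv).
Proof.
move=> uL vL [guL hu] [gvL hv]; split; first exact: L2_sub.
move=> phi tphi; have pL : L2 Omega phi := @test_L2 [::] phi tphi.
have DL := @test_L2 s phi tphi.
have -> : (fun x => (u \- v) x * D s phi x) =
    (fun x => u x * D s phi x - v x * D s phi x).
  by apply/funext => x; rewrite mulrBl.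
have -> : (fun x => (gu \- gv) x * phi x) =
    (fun x => gu x * phi x - gv x * phi x).
  by apply/funext => x; rewrite mulrBl.
by rewrite !integ_sub ?mulrBr ?hu ?hv //; exact: L2_mul.
Qed.

Lemma Hk_sub k u v : Hk Omega k u -> Hk Omega k v -> Hk Omega k (u \- v).
Proof.
move=> [uL hu] [vL hv]; split; first exact: L2_sub.
move=> s /[dup] /hu [gu Hu] /hv [gv Hv]; exists (gu \- gv).
exact: is_wderiv_sub.
Qed.

(** The three derivatives are independently chosen representatives; the difference of two of them is
    a weak derivative of [u - v], so uniqueness applies. *)
Lemma dx_sub i u v : Hk Omega 1 u -> Hk Omega 1 v ->
  ae_eq_on Omega (dx Omega i (u \- v)) (dx Omega i u \- dx Omega i v).
Proof.
move=> Hu Hv; have [_ /(_ [:: i] isT)/wderivP h] := Hk_sub Hu Hv.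
apply: is_wderiv_unique h _.
case: Hu Hv => [uL /(_ [:: i] isT)/wderivP h1] [vL /(_ [:: i] isT)/wderivP h2].
exact: (is_wderiv_sub uL vL h1 h2).
Qed.

(** The term [i = 0] of the seminorm counts zero derivatives in the direction [0], whence the order
    of the two squares. *)
Lemma snorm1E u :
  snorm Omega 1 u = Num.sqrt (L2norm Omega (dx Omega 1 u) ^+ 2 +
                              L2norm Omega (dx Omega 0 u) ^+ 2).
Proof.
by rewrite /snorm sum_ord2.
Qed.

Lemma snorm_ge0 k u : 0 <= snorm Omega k u.
Proof. exact: sqrtr_ge0. Qed.

Lemma L2norm_sub u v : L2 Omega u -> L2 Omega v ->
  L2norm Omega (u \- v) <= L2norm Omega u + L2norm Omega v.
Proof.
move=> uL vL; have vL' := L2_scale mO (-1) vL.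
have := L2norm_add mO uL vL'; rewrite (L2norm_scale mO) // normrN1 mul1r.
by congr (L2norm _ _ <= _); apply/funext => x /=; rewrite mulN1r.
Qed.

Lemma snorm_sub u v : Hk Omega 1 u -> Hk Omega 1 v ->
  snorm Omega 1 (u \- v) <= snorm Omega 1 u + snorm Omega 1 v.
Proof.
move=> Hu Hv; rewrite !snorm1E; apply: le_trans (sqrtD2_triangle _ _ _ _).
have h i : L2norm Omega (dx Omega i (u \- v)) <=
    L2norm Omega (dx Omega i u) + L2norm Omega (dx Omega i v).
  rewrite (ae_L2norm mO _ _ (dx_sub i Hu Hv)); first by apply: L2norm_sub; exact: dx_L2.
    exact: dx_L2.
  by apply: L2_sub => //; exact: dx_L2.
by apply: sqrtD2_mono => //; exact: L2norm_ge0.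
Qed.

Lemma H1norm_sub u v : Hk Omega 1 u -> Hk Omega 1 v ->
  H1norm Omega (u \- v) <= H1norm Omega u + H1norm Omega v.
Proof.
move=> Hu Hv; apply: le_trans (sqrtD2_triangle _ _ _ _).
apply: sqrtD2_mono; [exact: L2norm_ge0| |exact: snorm_ge0|exact: snorm_sub].
by apply: L2norm_sub; [case: Hu|case: Hv].
Qed.
End WeakDerivatives.

(** * Classical derivatives of test functions are weak ones; stability of [H10] under subtraction *)

Section IntegrationByParts.
Variables (R : realType) (Omega : set (R * R)).
Notation RR := (measurableTypeR R * measurableTypeR R)%type.
Notation mu := (@leb2 R).
Notation leb := (@lebesgue_measure R).
Notation D := Defs.iterD.
Implicit Types (u v f g phi psi : R * R -> R) (s : seq 'I_2) (i : 'I_2).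

(** The fundamental theorem of calculus on [[-M, M]], at whose endpoints [F] vanishes. *)
Lemma integral_derive_compact (F dF : R -> R) (M : R) : 0 < M ->
  continuous dF -> (forall t : R, is_derive t 1 F (dF t)) ->
  (forall t, M <= `|t| -> F t = 0) -> (forall t, M <= `|t| -> dF t = 0) ->
  (\int[leb]_t (dF t)%:E = 0)%E.
Proof.
move=> M0 cdF FdF F0 dF0.
have cF : continuous F.
  move=> t; apply: differentiable_continuous; apply/derivable1_diffP.
  by have [] := FdF t.
have MM : - M < M by rewrite gtrN.
pose I := `[- M, M]%classic.
have -> : (\int[leb]_t (dF t)%:E = \int[leb]_(t in I) (dF t)%:E)%E.
  rewrite [RHS]integral_mkcond; apply: eq_integral => t _; rewrite patchE.
  case: ifPn => //; rewrite notin_setE /I /= in_itv /= -ler_norml => /negP.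
  by rewrite -ltNge => /ltW /dF0 ->.
rewrite (@continuous_FTC2 _ dF F) //.
- by rewrite !F0 ?subee ?normrN ?ler_norm.
- exact: continuous_subspaceT.
- split.
  + by move=> t _; have [] := FdF t.
  + by apply: cvg_at_right_filter; exact: cF.
  + by apply: cvg_at_left_filter; exact: cF.
- by move=> t _; rewrite derive1E; have [] := FdF t.
Qed.

Lemma is_derive_slice1 f (x y : R) df : is_derive (x, y) (e_ R 0) f df ->
  is_derive x 1 (fun t => f (t, y)) df.
Proof.
have E : (fun h : R => h^-1 *: (f (h *: e_ R 0 + (x, y)) - f (x, y))) =
  (fun h : R => h^-1 *: (f (h *: 1 + x, y) - f (x, y))).
  apply/funext => h; congr (_ *: (f _ - _)).
  by rewrite -[LHS]/(h *: 1 + x, h *: 0 + y) scaler0 add0r.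
move=> [d1 d2]; apply: DeriveDef.
  by move: d1; rewrite /derivable /= E.
by move: d2; rewrite /derive /= E.
Qed.

Lemma is_derive_slice2 f (x y : R) df : is_derive (x, y) (e_ R 1) f df ->
  is_derive y 1 (fun t => f (x, t)) df.
Proof.
have E : (fun h : R => h^-1 *: (f (h *: e_ R 1 + (x, y)) - f (x, y))) =
  (fun h : R => h^-1 *: (f (x, h *: 1 + y) - f (x, y))).
  apply/funext => h; congr (_ *: (f _ - _)).
  by rewrite -[LHS]/(h *: 0 + x, h *: 1 + y) scaler0 add0r.
move=> [d1 d2]; apply: DeriveDef.
  by move: d1; rewrite /derivable /= E.
by move: d2; rewrite /derive /= E.
Qed.

Hypotheses (oO : open Omega) (bO : bounded_set Omega).
Let mO : measurable (Omega : set RR) := open_measurable2 oO.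

(** Fubini's theorem, the inner integral running in the direction [i] of the derivative: on each
    line it is the integral of the derivative of a compactly supported function. *)
Lemma integ_derive0 (F dF : R * R -> R) i : continuous dF ->
  (forall x, is_derive x (e_ R i) F (dF x)) ->
  (forall x, ~ Omega x -> F x = 0) -> (forall x, ~ Omega x -> dF x = 0) ->
  integ Omega dF = 0.
Proof.
move=> cdF FdF F0 dF0; rewrite integ_mkcond // /Rintegral.
have -> : dF \_ Omega = dF.
  apply/funext => x; rewrite patchE; case: ifPn => //.
  by rewrite notin_setE => /dF0 ->.
have idF : mu.-integrable setT (EFin \o dF).
  have : mu.-integrable Omega (EFin \o dF).
    by apply: L2_integrable => //; exact: continuous_L2.
  move/(integrable_mkcond _ mO); apply: eq_integrable => // x _.
  rewrite patchE /=; case: ifPn => //.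
  by rewrite notin_setE => /dF0 ->.
have [M M0 OM] := bounded_box bO.
(* [M + 1] instead of [M], since [Omega] is only known to lie in the closed box of half-width
   [M]. *)
have out x : M + 1 <= `|x.1| \/ M + 1 <= `|x.2| -> ~ Omega x.
  move=> h /OM [/=]; rewrite !in_itv /= -!ler_norml => h1 h2.
  by case: h => h; [have := le_trans h h1|have := le_trans h h2]; lra.
suff -> : (\int[mu]_x (dF x)%:E = 0)%E by [].
have M1 : 0 < M + 1 by lra.
have cpair1 (y : R) : continuous (fun t : R => (t, y)).
  by move=> t; exact: (cvg_pair (@cvg_id R (nbhs t)) (cvg_cst y)).
have cpair2 (x : R) : continuous (fun t : R => (x, t)).
  by move=> t; exact: (cvg_pair (cvg_cst x) (@cvg_id R (nbhs t))).
have [i0|i1] : i = 0 \/ i = 1.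
  by case: i {FdF} => [[|[|//]] ilt]; [left|right]; exact: val_inj.
- rewrite -[LHS](integral21_prod_meas1 idF) integral0_eq // => y _.
  apply: (@integral_derive_compact (fun t => F (t, y)) (fun t => dF (t, y)) (M + 1)) => //.
  + by move=> t; apply: continuous_comp; [exact: cpair1|exact: cdF].
  + by move=> t; apply: is_derive_slice1; rewrite -i0.
  + by move=> t h; apply: F0; apply: out; left.
  + by move=> t h; apply: dF0; apply: out; left.
- rewrite -[LHS](integral12_prod_meas1 idF) integral0_eq // => x _.
  apply: (@integral_derive_compact (fun t => F (x, t)) (fun t => dF (x, t)) (M + 1)) => //.
  + by move=> t; apply: continuous_comp; [exact: cpair2|exact: cdF].
  + by move=> t; apply: is_derive_slice2; rewrite -i1.
  + by move=> t h; apply: F0; apply: out; right.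
  + by move=> t h; apply: dF0; apply: out; right.
Qed.

Lemma test_out phi x : test_function Omega phi -> ~ Omega x ->
  phi x = 0.
Proof.
move=> [_ _ Ophi]; apply: contra_notP => /eqP h; apply: Ophi.
exact: subset_closure.
Qed.

Lemma test_derive phi i x : test_function Omega phi ->
  is_derive x (e_ R i) phi (D [:: i] phi x).
Proof. by move=> [/(_ [::])[_ /(_ i x)] h _ _]; exact: derivableP. Qed.

(** The derivative of the product [phi * psi] integrates to zero, because the product and its
    derivative vanish outside [Omega]. *)
Lemma test_wderiv phi i : test_function Omega phi ->
  is_wderiv Omega [:: i] phi (D [:: i] phi).
Proof.
move=> tphi; split; first exact: test_L2.
move=> psi tpsi; rewrite /= expr1 mulN1r.
pose F x := phi x * psi x.
pose dF x := phi x * D [:: i] psi x + psi x * D [:: i] phi x.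
have cphi : continuous phi := @test_continuous _ _ [::] phi tphi.
have cpsi : continuous psi := @test_continuous _ _ [::] psi tpsi.
have cdphi : continuous (D [:: i] phi) by exact: (test_continuous tphi).
have cdpsi : continuous (D [:: i] psi) by exact: (test_continuous tpsi).
have : integ Omega dF = 0.
  apply: (@integ_derive0 F _ i).
  - move=> x; apply: cvgD; apply: cvgM; [exact: cphi|exact: cdpsi|exact: cpsi|exact: cdphi].
  - by move=> x; apply: is_deriveM; exact: test_derive.
  - by move=> x Ox; rewrite /F (test_out tphi Ox) mul0r.
  - by move=> x Ox; rewrite /dF (test_out tphi Ox) (test_out tpsi Ox) !mul0r addr0.
rewrite /dF integ_add //; try by apply: L2_mul => //; exact: continuous_L2.
move/eqP; rewrite addr_eq0 => /eqP ->; congr (- integ _ _).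
by apply/funext => x; rewrite mulrC.
Qed.

Lemma wderiv_nil u : L2 Omega u -> is_wderiv Omega [::] u u.
Proof. by move=> uL; split => // phi _; rewrite expr0 mul1r. Qed.

Lemma test_Hk1 phi : test_function Omega phi -> Hk Omega 1 phi.
Proof.
move=> tphi; have pL : L2 Omega phi by exact: (@test_L2 _ _ oO bO [::]).
split => // -[|i [|//]] _; first by exists phi; exact: wderiv_nil.
by exists (D [:: i] phi); exact: test_wderiv.
Qed.

(** Approximate [u] and [v] to within [eps / 2]. The triangle inequality for [H1norm] asks for weak
    differentiability of the approximating test functions, which [test_Hk1] provides. *)
Lemma H10_sub u v : H10 Omega u -> H10 Omega v -> H10 Omega (u \- v).
Proof.
move=> [Hu hu] [Hv hv]; split; first exact: Hk_sub.
move=> eps eps0; have e2 : 0 < eps / 2 by rewrite divr_gt0.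
have [phi tphi uphi] := hu _ e2; have [psi tpsi vpsi] := hv _ e2.
exists (phi \- psi); first exact: test_sub.
have -> : (u \- v) \- (phi \- psi) = (u \- phi) \- (v \- psi).
  by apply/funext => x /=; ring.
apply: le_lt_trans (H1norm_sub oO bO _ _) _; try (apply: Hk_sub => //; exact: test_Hk1).
by rewrite [ltRHS]splitr; exact: ltrD uphi vpsi.
Qed.

Lemma vH10_sub (v w : 'I_2 -> R * R -> R) :
  vH10 Omega v -> vH10 Omega w -> vH10 Omega (vsub v w).
Proof. by move=> Hv Hw i; exact: H10_sub. Qed.
End IntegrationByParts.

(** * Discrete spaces *)

Section DiscreteSpaces.
Variables (R : realType) (Omega : set (R * R)) (tau : set (set (R * R))).
Notation RR := (measurableTypeR R * measurableTypeR R)%type.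
Notation mu := (@leb2 R).
Hypotheses (oO : open Omega) (bO : bounded_set Omega) (O0 : Omega !=set0).
Hypothesis part : fe_partition Omega tau.
Implicit Types (f u v : R * R -> R) (K : set (R * R)) (k : nat).

Lemma continuous_sum (T : topologicalType) (I : Type) (r : seq I) (Q : pred I)
    (F : I -> T -> R) : (forall i, continuous (F i)) ->
  continuous (fun x => \sum_(i <- r | Q i) F i x).
Proof.
move=> cF; elim: r => [|i r IH] x.
  rewrite (_ : (fun x => _) = cst 0); first exact: cvg_cst.
  by apply/funext => y; rewrite big_nil.
rewrite (_ : (fun x => _) = fun x => (if Q i then F i x else 0) +
    \sum_(j <- r | Q j) F j x); last first.
  by apply/funext => y; rewrite big_cons; case: ifP; rewrite ?add0r.
by apply: cvgD; [case: ifP => _; [exact: cF|exact: cvg_cst]|exact: IH].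
Qed.

Lemma polyfun_continuous k coef : continuous (polyfun k coef : R * R -> R).
Proof.
have cX n : continuous (fun t : R => t ^+ n) by move=> t; exact: exprn_continuous.
apply: continuous_sum => i; apply: continuous_sum => j x.
apply: cvgM; [apply: cvgM; first exact: cvg_cst|].
  by apply: (@continuous_comp _ _ _ fst (fun t : R => t ^+ i)); [exact: cvg_fst|exact: cX].
by apply: (@continuous_comp _ _ _ snd (fun t : R => t ^+ j)); [exact: cvg_snd|exact: cX].
Qed.

Lemma poly_on_sub k K u v : poly_on k K u -> poly_on k K v -> poly_on k K (u \- v).
Proof.
move=> [a ua] [b vb]; exists (fun i j => a i j - b i j).
apply: filterS2 ua vb => x hu hv Kx; rewrite /= hu // hv // /polyfun -sumrB.
by apply: eq_bigr => i _; rewrite -sumrB; apply: eq_bigr => j _; rewrite !mulrBl.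
Qed.

Lemma within_sub u v : {within Omega, continuous u} ->
  {within Omega, continuous v} -> {within Omega, continuous (u \- v)}.
Proof. by move=> cu cv x; apply: cvgB; [exact: cu|exact: cv]. Qed.

Lemma Rh_sub u v : Rh Omega tau u -> Rh Omega tau v -> Rh Omega tau (u \- v).
Proof.
move=> [Hu cu pu] [Hv cv pv]; split; first exact: H10_sub.
- exact: within_sub.
- by move=> K tK; apply: poly_on_sub; [exact: pu|exact: pv].
Qed.

Lemma Xh_sub (u v : 'I_2 -> R * R -> R) :
  Xh Omega tau u -> Xh Omega tau v -> Xh Omega tau (vsub u v).
Proof.
move=> [Hu cu pu] [Hv cv pv]; split; first exact: vH10_sub.
- by move=> i; apply: within_sub.
- by move=> i K tK; apply: poly_on_sub; [exact: pu|exact: pv].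
Qed.

Lemma L20_sub p q : L20 Omega p -> L20 Omega q -> L20 Omega (p \- q).
Proof.
have mO := open_measurable2 oO.
move=> [pL p0] [qL q0]; split; first exact: L2_sub.
by rewrite integ_sub // ?p0 ?q0 ?subrr //; exact: L2_integrable.
Qed.

Lemma Qh_sub p q : Qh Omega tau p -> Qh Omega tau q -> Qh Omega tau (p \- q).
Proof.
move=> [Lp pp] [Lq pq]; split; first exact: L20_sub.
by move=> K tK; apply: poly_on_sub; [exact: pp|exact: pq].
Qed.

(** Finitely many elements cover [Omega], and each of the polynomials is bounded on the bounded set
    [Omega]. *)
Lemma piecewise_poly_bounded k f : (forall K, tau K -> poly_on k K f) ->
  exists M : R, {ae mu, forall x, Omega x -> `|f x| <= M}.
Proof.
move=> pf; have /finite_seqP[s tauE] := fe_finite part.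
(* Restricting to the points covered by a finite list of elements allows an induction on the
   list. *)
suff [M hM] : exists M : R, {ae mu, forall x, Omega x ->
    (exists2 K, K \in s & K x) -> `|f x| <= M}.
  exists M; apply: filterS hM => x h Ox; apply: h => //.
  have : closure Omega x by exact: subset_closure.
  by rewrite -(fe_cover part) tauE => -[K Ks Kx]; exists K.
have {}pf K : K \in s -> poly_on k K f by move=> Ks; apply: pf; rewrite tauE.
elim: s pf {tauE} => [_|K s IH pf].
  by exists 0; apply: aeW => x _ [].
have [|M hM] := IH; first by move=> K' Ks; apply: pf; rewrite inE Ks orbT.
have [coef hf] := pf K (mem_head _ _).
have [N _ hN] := continuous_bounded bO (@polyfun_continuous k coef).
exists (Num.max M N); apply: filterS2 hM hf => x h1 h2 Ox [K'].
rewrite inE => /predU1P[-> /h2 -> |Ks K'x]; first by rewrite le_max hN ?orbT.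
by rewrite le_max h1 //; exists K'.
Qed.

Lemma box_edist (M : R) x y : crect ((- M, M), (- M, M)) x ->
  crect ((- M, M), (- M, M)) y ->
  Defs.edist x y <= Num.sqrt ((2 * M) ^+ 2 + (2 * M) ^+ 2).
Proof.
move=> [/= + +] [/= + +]; rewrite !in_itv /= => /andP[a1 a2] /andP[b1 b2] /andP[c1 c2] /andP[d1 d2].
apply: ler_wsqrtr; apply: lerD.
  by rewrite -[leLHS]real_normK ?num_real // ler_sqr ?nnegrE //;
     rewrite ?ler_norml; try (apply/andP; split); lra.
by rewrite -[leLHS]real_normK ?num_real // ler_sqr ?nnegrE //;
   rewrite ?ler_norml; try (apply/andP; split); lra.
Qed.

(** An element has an interior point, hence contains two distinct points. All distances are bounded,
    the elements lying in a box, so the supremum is indeed an upper bound. Positivity permits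
    division by the mesh size. *)
Lemma mesh_size_gt0 : 0 < mesh_size tau.
Proof.
have [M M0 OM] := bounded_box bO.
have KM K : tau K -> K `<=` crect ((- M, M), (- M, M)).
  move=> tK; apply: (@subset_trans _ (closure Omega)).
    by rewrite -(fe_cover part); exact: bigcup_sup.
  have /closure_id -> : closed (crect ((- M, M), (- M, M))).
    apply: compact_closed; first exact: norm_hausdorff.
    by apply: compact_setX; exact: segment_compact.
  exact: closureS.
have [x Ox] := O0.
have : closure Omega x by exact: subset_closure.
rewrite -(fe_cover part) => -[K tK _].
have [y Ky] := fe_nonempty part tK.
have /nbhs_ballP[e /= e0 eK] := Ky.
pose z : R * R := (y.1 + e / 2, y.2).
have Kz : K z.
  apply: eK; split; rewrite /ball /=; last by rewrite subrr normr0.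
  rewrite opprD addrA subrr add0r normrN gtr0_norm ?divr_gt0 //; lra.
have Kyy : K y by exact: nbhs_singleton.
have dyz : Defs.edist z y = e / 2.
  rewrite /Defs.edist /= subrr expr0n addr0 addrAC subrr add0r sqrtr_sqr gtr0_norm //.
  by rewrite divr_gt0.
apply: (@lt_le_trans _ _ (e / 2)); first by rewrite divr_gt0.
rewrite /mesh_size; apply: ub_le_sup; last by exists K, z, y; split.
exists (Num.sqrt ((2 * M) ^+ 2 + (2 * M) ^+ 2)) => _ [K' [a [b [tK' K'a K'b ->]]]].
by apply: box_edist; exact: (KM K').
Qed.
End DiscreteSpaces.

(** * The energy argument *)

(** If the conclusion fails, then [d <= s], so that the right-hand side is at most [(m1 + m2) s d],
    which is less than [k1 s^2]. The summand [1] in the constant serves to obtain [d <= s]. *)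
Lemma quadratic_absorb (R : realFieldType) (k1 m1 m2 s d : R) :
  0 < k1 -> 0 <= m1 -> 0 <= m2 -> 0 <= s -> 0 <= d ->
  k1 * s ^+ 2 <= m1 * (s * d) + m2 * d ^+ 2 -> s <= ((m1 + m2) / k1 + 1) * d.
Proof.
move=> k0 m10 m20 s0 d0 h; rewrite leNgt; apply/negP => hs.
have ds : d <= s.
  apply: le_trans (ltW hs); rewrite -[leLHS]mul1r ler_wpM2r // lerDr.
  by rewrite divr_ge0 ?addr_ge0 // ltW.
have sp : 0 < s by apply: le_lt_trans hs; rewrite mulr_ge0 // addr_ge0 // divr_ge0 ?addr_ge0 // ltW.
have h1 : (m1 + m2) * d + k1 * d < k1 * s.
  have -> : (m1 + m2) * d + k1 * d = k1 * (((m1 + m2) / k1 + 1) * d).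
    by field; rewrite gt_eqF.
  by rewrite ltr_pM2l.
have h2 : ((m1 + m2) * d + k1 * d) * s < k1 * s * s by rewrite ltr_pM2r.
have h3 : m2 * d ^+ 2 <= m2 * (d * s) by rewrite ler_wpM2l // expr2 ler_wpM2l.
have h4 : 0 <= k1 * d * s by rewrite !mulr_ge0 // ltW.
have e1 : ((m1 + m2) * d + k1 * d) * s = m1 * (s * d) + m2 * (d * s) + k1 * d * s by ring.
have e2 : k1 * s * s = k1 * s ^+ 2 by ring.
by rewrite e1 e2 in h2; lra.
Qed.

(** The real inequality behind the error estimate. [E] and [F] are the velocity and temperature
    errors, [d1], [d2], [d3] the distances of velocity, temperature and pressure to their discrete
    approximants, and [p] is the discrete pressure error. The first assumption relating them comes
    from the inf-sup condition, the second from the tested error equation. *)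
Lemma energy_bound (R : realFieldType) (k a G N1 N2 B r L : R) :
  0 <= k -> 0 <= a -> 0 <= G -> 0 <= N1 -> 0 <= N2 -> 0 <= B -> 0 < r -> 0 < L ->
  0 < k / 2 - (N1 + N2) * B - G -> 0 < a / 2 - G / 2 - 5 * N2 * B ->
  exists2 M : R, 0 < M & forall E F d1 d2 d3 p : R,
    0 <= E -> 0 <= F -> 0 <= d1 -> 0 <= d2 -> 0 <= d3 -> 0 <= p ->
    r * L * p <= 2 * r * d3 + (k + 2 * N1 * B) * E + G * F ->
    k * E ^+ 2 + a * F ^+ 2 <= k * E * d1 + a * F * d2
      + (2 * N1 * B * E + G * F) * (E + d1) + N2 * B * (E + F) * (F + d2)
      + 2 * r * E * d3 + 2 * r * d1 * (d3 + p) ->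
    E + F <= M * (d1 + d2 + d3).
Proof.
move=> k0 a0 G0 N10 N20 B0 r0 L0.
set l1 := k / 2 - _ - _; set l2 := a / 2 - _ - _ => l10 l20.
have nn (x y : R) : 0 <= x -> 0 <= y -> 0 <= x * y by exact: mulr_ge0.
have le_of_eq (x y : R) : x = y -> x <= y by move=> ->.
have N1B := nn _ _ N10 B0; have N2B := nn _ _ N20 B0.
(* As [(E + F)^2 <= 2 (E^2 + F^2)], the quantity [kap (E + F)^2] is at most [2 l1 E^2 + 2 l2 F^2].
   This is no more than what remains of the diffusion after subtracting the terms quadratic in [E]
   and [F]. *)
pose kap := Num.min l1 l2; have kap0 : 0 < kap by rewrite /kap lt_min l10.
have kap1 : kap <= l1 by rewrite /kap ge_min lexx.
have kap2 : kap <= l2 by rewrite /kap ge_min lexx orbT.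
pose n1 := N1 * B; pose n2 := N2 * B.
(* [m1] collects the coefficients of the products of an error with [d1 + d2 + d3], and [m2] those of
   the square of that sum. The terms with [2 / L] and [4 * r / L] stem from the pressure. *)
pose m1 := k + a + 2 * n1 + G + n2 + 2 * r + 2 / L * (k + 2 * n1 + G).
pose m2 := 2 * r + 4 * r / L.
have Li : 0 < L^-1 by rewrite invr_gt0.
have {}Li := ltW Li; have r0' := ltW r0.
have two0 : 0 <= (2 : R) by []; have four0 : 0 <= (4 : R) by [].
have m10 : 0 <= m1.
  by rewrite /m1 /n1 /n2; do ![assumption | apply: addr_ge0 | apply: mulr_ge0].
have m20 : 0 <= m2.
  by rewrite /m2; do ![assumption | apply: addr_ge0 | apply: mulr_ge0].
exists ((m1 + m2) / kap + 1).
  by rewrite ltr_wpDl //; exact: divr_ge0 (addr_ge0 m10 m20) (ltW kap0).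
move=> E F d1 d2 d3 p E0 F0 d10 d20 d30 p0 hp hE.
apply: quadratic_absorb => //; try by rewrite !addr_ge0.
have E2 : 0 <= E ^+ 2 by exact: sqr_ge0.
have F2 : 0 <= F ^+ 2 by exact: sqr_ge0.
set d := d1 + d2 + d3.
have d0 : 0 <= d by rewrite /d !addr_ge0.
have dd1 : d1 <= d by rewrite /d; lra.
have dd2 : d2 <= d by rewrite /d; lra.
have dd3 : d3 <= d by rewrite /d; lra.
have {}hp : 2 * r * p <= 2 / L * (2 * r * d3 + (k + 2 * n1) * E + G * F).
  have -> : 2 * r * p = 2 / L * (r * L * p) by field; rewrite gt_eqF.
  by apply: ler_wpM2l; [rewrite divr_ge0 // ltW|rewrite /n1 mulrA].
have [Ed1 Ed2 Ed3] : [/\ E * d1 <= E * d, E * d2 <= E * d & E * d3 <= E * d].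
  by split; apply: ler_wpM2l.
have [Fd1 Fd2] : F * d1 <= F * d /\ F * d2 <= F * d.
  by split; apply: ler_wpM2l.
have [Ed Fd] : 0 <= E * d /\ 0 <= F * d by split; exact: nn.
have d13 : d1 * d3 <= d ^+ 2 by rewrite expr2; exact: ler_pM.
have EF : 2 * (E * F) <= E ^+ 2 + F ^+ 2 by have := sqr_ge0 (E - F); lra.
have hdp : d1 * (2 * r * p) <=
    2 / L * (2 * r * (d1 * d3) + (k + 2 * n1) * (E * d1) + G * (F * d1)).
  apply: le_trans (ler_wpM2l d10 hp) _; apply: le_of_eq; ring.
have leM (x y z : R) : 0 <= x -> y <= z -> x * y <= x * z by move=> ? ?; exact: ler_wpM2l.
have kn1 : 0 <= k + 2 * n1 by do ![assumption | apply: addr_ge0 | apply: mulr_ge0].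
have hdp' : d1 * (2 * r * p) <=
    2 / L * (2 * r * d ^+ 2 + (k + 2 * n1) * (E * d) + G * (F * d)).
  apply: le_trans hdp _; apply: (leM); first by rewrite divr_ge0 // ltW.
  apply: lerD; [apply: lerD|exact: (leM)].
    by apply: (leM) => //; exact: mulr_ge0.
  exact: (leM).
have t1 := leM _ _ _ k0 Ed1.
have t2 := leM _ _ _ a0 Fd2.
have t3 : 2 * n1 * (E * d1) <= 2 * n1 * (E * d) by apply: (leM) => //; do ![assumption | apply: mulr_ge0].
have t4 := leM _ _ _ G0 Fd1.
have t5 : n2 * (E * d2) <= n2 * (E * d) by exact: (leM).
have t6 : n2 * (F * d2) <= n2 * (F * d) by exact: (leM).
have t7 : 2 * r * (E * d3) <= 2 * r * (E * d) by apply: (leM) => //; do ![assumption | apply: mulr_ge0].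
have t8 : 2 * r * (d1 * d3) <= 2 * r * d ^+ 2 by apply: (leM) => //; do ![assumption | apply: mulr_ge0].
have t9 : G * (2 * (E * F)) <= G * (E ^+ 2 + F ^+ 2) by exact: (leM).
have t10 : n2 * (2 * (E * F)) <= n2 * (E ^+ 2 + F ^+ 2) by exact: (leM).
have u1 : kap * E ^+ 2 <= l1 * E ^+ 2 by apply: ler_wpM2r.
have u2 : kap * F ^+ 2 <= l2 * F ^+ 2 by apply: ler_wpM2r.
have u3 : kap * (2 * (E * F)) <= kap * (E ^+ 2 + F ^+ 2) by apply: (leM) => //; exact: ltW.
have q1 := nn _ _ G0 E2. have q2 := nn _ _ G0 F2.
have q3 := nn _ _ N2B E2. have q4 := nn _ _ N2B F2.
have q5 := nn _ _ a0 Ed. have q6 := nn _ _ k0 Fd.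
have q7 := nn _ _ N1B Fd. have q8 := nn _ _ G0 Ed.
have q9 : 0 <= r * (F * d) by do ![assumption | apply: mulr_ge0].
have w1 : 0 <= L^-1 * (k + 2 * n1) * (F * d) by do ![assumption | apply: mulr_ge0].
have w2 : 0 <= L^-1 * G * (E * d) by do ![assumption | apply: mulr_ge0].
rewrite /m1 /m2; rewrite /l1 in u1; rewrite /l2 in u2.
rewrite -/n1 -/n2 in q3 q4 q7.
have hE' : k * E ^+ 2 + a * F ^+ 2 <= k * (E * d1) + a * (F * d2)
   + 2 * n1 * E ^+ 2 + G * (E * F) + 2 * n1 * (E * d1) + G * (F * d1)
   + n2 * (E * F) + n2 * F ^+ 2 + n2 * (E * d2) + n2 * (F * d2)
   + 2 * r * (E * d3) + 2 * r * (d1 * d3) + d1 * (2 * r * p).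
  by apply: le_trans hE _; rewrite /n1 /n2; apply: le_of_eq; ring.
clear hE hp hdp leM nn.
have v1 : (k / 2 - (N1 + N2) * B - G) * E ^+ 2 =
   k * E ^+ 2 / 2 - n1 * E ^+ 2 - n2 * E ^+ 2 - G * E ^+ 2 by rewrite /n1 /n2; ring.
have v2 : (a / 2 - G / 2 - 5 * N2 * B) * F ^+ 2 =
   a * F ^+ 2 / 2 - G * F ^+ 2 / 2 - 5 * (n2 * F ^+ 2) by rewrite /n2; ring.
rewrite v1 in u1; rewrite v2 in u2; lra.
Qed.

Section SqrtSums2.
Variable R : realType.
Implicit Types a b : 'I_2 -> R.

Lemma sum_sqr_ge0 a : 0 <= \sum_i a i ^+ 2.
Proof. by apply: sumr_ge0 => i _; exact: sqr_ge0. Qed.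

Lemma cauchy_sum2 a b :
  \sum_i a i * b i <= Num.sqrt (\sum_i a i ^+ 2) * Num.sqrt (\sum_i b i ^+ 2).
Proof. by rewrite !sum_ord2; exact: cauchy2. Qed.

Lemma triangle_sum2 a b c : (forall i, 0 <= c i <= a i + b i) ->
  Num.sqrt (\sum_i c i ^+ 2) <=
  Num.sqrt (\sum_i a i ^+ 2) + Num.sqrt (\sum_i b i ^+ 2).
Proof.
move=> h; rewrite !sum_ord2; apply: le_trans (sqrtD2_triangle _ _ _ _).
by have /andP[? ?] := h 0; have /andP[? ?] := h 1; exact: sqrtD2_mono.
Qed.

Lemma le_sqrt_sum2 a i : 0 <= a i -> a i <= Num.sqrt (\sum_j a j ^+ 2).
Proof.
move=> ai; rewrite -[leLHS]ger0_norm // -sqrtr_sqr; apply: ler_wsqrtr.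
by rewrite (bigD1 i) //= lerDl; apply: sumr_ge0 => j _; exact: sqr_ge0.
Qed.
End SqrtSums2.

(* The inner product [ip], its norm [nL], the partial derivatives [d] and the
   pointwise product [mul] are abstract: unifying two distinct weak derivatives
   or seminorms by unfolding them is intractable.  The predicate [bd] stands for
   essential boundedness; only test functions have to satisfy it, so that the
   trilinear forms split without any Sobolev embedding. *)
Section Galerkin.
Variables (R : realType) (F : zmodType).
Notation V := ('I_2 -> F).
Variables (ip : F -> F -> R) (nL : F -> R) (d : 'I_2 -> F -> F) (mul : F -> F -> F).
Variables (L2 H bd : F -> Prop).
Implicit Types (f g h T theta q : F) (u v w : V).
Hypothesis nL_ge0 : forall f, 0 <= nL f.
Hypothesis ipC : forall f g, ip f g = ip g f.
Hypothesis ip_self : forall f, L2 f -> ip f f = nL f ^+ 2.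
Hypothesis ip_le : forall f g, L2 f -> L2 g -> `|ip f g| <= nL f * nL g.
Hypothesis ip_subl : forall f g h, L2 f -> L2 g -> L2 h ->
  ip (f - g) h = ip f h - ip g h.
Hypothesis L2_sub : forall f g, L2 f -> L2 g -> L2 (f - g).
Hypothesis H_L2 : forall f, H f -> L2 f.
Hypothesis H_sub : forall f g, H f -> H g -> H (f - g).
Hypothesis d_L2 : forall i f, L2 (d i f).
Hypothesis ip_d_subl : forall i f g h, H f -> H g -> L2 h ->
  ip (d i (f - g)) h = ip (d i f) h - ip (d i g) h.
Hypothesis mul_L2 : forall f g, H f -> bd f -> L2 g -> L2 (mul f g).
Hypothesis mul_subr : forall f g h, mul f (g - h) = mul f g - mul f h.

Definition gip T theta : R := \sum_j ip (d j T) (d j theta).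
Definition nH T : R := Num.sqrt (\sum_j nL (d j T) ^+ 2).
Definition nV v : R := Num.sqrt (\sum_i nH (v i) ^+ 2).
Definition subV u v : V := fun i => u i - v i.
Definition HV v : Prop := forall i, H (v i).

Lemma ip_subr f g h : L2 f -> L2 g -> L2 h -> ip h (f - g) = ip h f - ip h g.
Proof. by move=> fL gL hL; rewrite ipC ip_subl // (ipC f) (ipC g). Qed.

Lemma gipC T theta : gip T theta = gip theta T.
Proof. by apply: eq_bigr => j _; rewrite ipC. Qed.

Lemma gip_subl T theta f : H T -> H theta ->
  gip (T - theta) f = gip T f - gip theta f.
Proof.
by move=> HT Ht; rewrite /gip -sumrB; apply: eq_bigr => j _; exact: ip_d_subl.
Qed.

Lemma nH_ge0 T : 0 <= nH T. Proof. exact: sqrtr_ge0. Qed.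
Lemma nV_ge0 v : 0 <= nV v. Proof. exact: sqrtr_ge0. Qed.

Lemma gip_self T : gip T T = nH T ^+ 2.
Proof.
rewrite /nH sqr_sqrtr ?sum_sqr_ge0 //.
by apply: eq_bigr => j _; rewrite ip_self.
Qed.

Lemma gip_le T theta : `|gip T theta| <= nH T * nH theta.
Proof.
apply: le_trans (ler_norm_sum _ _ _) _; apply: le_trans _ (cauchy_sum2 _ _).
by apply: ler_sum => j _; exact: ip_le.
Qed.

Lemma nL_d_le i T : nL (d i T) <= nH T.
Proof. exact: (@le_sqrt_sum2 _ (fun i => nL (d i T))). Qed.

Lemma nH_le v i : nH (v i) <= nV v.
Proof. by apply: (@le_sqrt_sum2 _ (fun i => nH (v i))); exact: nH_ge0. Qed.

(** Additivity of [d i] is available only inside [ip]. Hence the difference is paired with itself,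
    expanded in the first argument, and the norm is divided out after the Cauchy-Schwarz
    inequality. *)
Lemma nL_d_sub i T theta : H T -> H theta ->
  nL (d i (T - theta)) <= nL (d i T) + nL (d i theta).
Proof.
move=> HT Ht; set n := nL (d i (T - theta)).
have [->|n0] := eqVneq n 0; first by rewrite addr_ge0.
have np : 0 < n by rewrite lt0r n0 nL_ge0.
rewrite -(ler_pM2r np) -expr2 -ip_self // ip_d_subl // mulrDl.
apply: le_trans (ler_norm _) _; apply: le_trans (ler_normB _ _) _.
by apply: lerD; exact: ip_le.
Qed.

Lemma nH_sub T theta : H T -> H theta -> nH (T - theta) <= nH T + nH theta.
Proof.
by move=> HT Ht; apply: triangle_sum2 => i; rewrite nL_ge0 nL_d_sub.
Qed.

Lemma HV_sub u v : HV u -> HV v -> HV (subV u v).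
Proof. by move=> Hu Hv i; exact: H_sub. Qed.

Lemma nV_sub u v : HV u -> HV v -> nV (subV u v) <= nV u + nV v.
Proof.
by move=> Hu Hv; apply: triangle_sum2 => i; rewrite nH_ge0 nH_sub.
Qed.

(** The zero test function enters below as a difference [T - T] of discrete functions. *)
Lemma nH_subrr T : H T -> nH (T - T) = 0.
Proof.
move=> HT; have : nH (T - T) ^+ 2 = 0 by rewrite -gip_self gip_subl // !subrr.
by move/eqP; rewrite sqrf_eq0 => /eqP.
Qed.

Variables (k0 kg ka r : R).
Hypotheses (k0_gt0 : 0 < k0) (kg_gt0 : 0 < kg) (ka_gt0 : 0 < ka) (r_gt0 : 0 < r).

(** In the trilinear forms below, the test function is grouped with the convecting field: the former
    being bounded, their product lies in [L2] and [ip] is additive there. *)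
Definition fa0 u v : R := k0 * \sum_i gip (u i) (v i).
Definition fa1 w u v : R := \sum_i \sum_j ip (d j (u i)) (mul (v i) (w j)).
Definition fa2 T v : R := kg * ip T (v 1).
Definition fa3 T theta : R := ka * gip T theta.
Definition fa4 w T theta : R := \sum_j ip (d j T) (mul theta (w j)).
Definition fb v q : R := r * \sum_i ip (d i (v i)) q.

Lemma fa0C u v : fa0 u v = fa0 v u.
Proof. by congr (_ * _); apply: eq_bigr => i _; exact: gipC. Qed.

Lemma fa0_subl u v w : HV u -> HV v -> fa0 (subV u v) w = fa0 u w - fa0 v w.
Proof.
move=> Hu Hv; rewrite /fa0 -mulrBr -sumrB; congr (_ * _).
by apply: eq_bigr => i _; exact: gip_subl.
Qed.

Lemma fa0_subr u v w : HV u -> HV v -> fa0 w (subV u v) = fa0 w u - fa0 w v.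
Proof. by move=> Hu Hv; rewrite !(fa0C w) fa0_subl. Qed.

Lemma fa0_self u : fa0 u u = k0 * nV u ^+ 2.
Proof.
rewrite /nV sqr_sqrtr ?sum_sqr_ge0 //; congr (_ * _).
by apply: eq_bigr => i _; exact: gip_self.
Qed.

Lemma fa0_le u v : `|fa0 u v| <= k0 * nV u * nV v.
Proof.
rewrite normrM gtr0_norm // -mulrA; apply: ler_wpM2l; first exact: ltW.
apply: le_trans (ler_norm_sum _ _ _) _; apply: le_trans _ (cauchy_sum2 _ _).
by apply: ler_sum => j _; exact: gip_le.
Qed.

Lemma fa3_subl T theta f : H T -> H theta ->
  fa3 (T - theta) f = fa3 T f - fa3 theta f.
Proof. by move=> HT Ht; rewrite /fa3 gip_subl // mulrBr. Qed.

Lemma fa3_subr T theta f : H T -> H theta ->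
  fa3 f (T - theta) = fa3 f T - fa3 f theta.
Proof.
by move=> HT Ht; rewrite /fa3 (gipC f) gip_subl // mulrBr !(gipC _ f).
Qed.

Lemma fa3_self T : fa3 T T = ka * nH T ^+ 2.
Proof. by rewrite /fa3 gip_self. Qed.

Lemma fa3_le T theta : `|fa3 T theta| <= ka * nH T * nH theta.
Proof.
rewrite normrM gtr0_norm // -mulrA; apply: ler_wpM2l; first exact: ltW.
exact: gip_le.
Qed.

Lemma fa2_subl T theta v : L2 T -> L2 theta -> HV v ->
  fa2 (T - theta) v = fa2 T v - fa2 theta v.
Proof. by move=> TL tL Hv; rewrite /fa2 ip_subl ?mulrBr //; exact: H_L2. Qed.

Variable c : R.
Hypothesis poincare : forall f, H f -> nL f <= c * nH f.

(** The factor [c^2] comes from the Poincare inequality applied to both arguments. *)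
Lemma fa2_le T v : H T -> HV v -> `|fa2 T v| <= kg * c ^+ 2 * nH T * nV v.
Proof.
move=> HT Hv; rewrite normrM gtr0_norm //.
have -> : kg * c ^+ 2 * nH T * nV v = kg * (c ^+ 2 * (nH T * nV v)) by ring.
apply: ler_wpM2l; first exact: ltW.
apply: le_trans (ip_le (H_L2 HT) (H_L2 (Hv 1))) _.
apply: le_trans (ler_pM (nL_ge0 _) (nL_ge0 _) (poincare HT) (poincare (Hv 1))) _.
have -> : c * nH T * (c * nH (v 1)) = c ^+ 2 * (nH T * nH (v 1)) by ring.
apply: ler_wpM2l; first exact: sqr_ge0.
by apply: ler_wpM2l; [exact: nH_ge0|exact: nH_le].
Qed.

Lemma fb_subl u v q : HV u -> HV v -> L2 q -> fb (subV u v) q = fb u q - fb v q.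
Proof.
move=> Hu Hv qL; rewrite /fb -mulrBr -sumrB; congr (_ * _).
by apply: eq_bigr => i _; exact: ip_d_subl.
Qed.

Lemma fb_subr v p q : L2 p -> L2 q -> fb v (p - q) = fb v p - fb v q.
Proof.
move=> pL qL; rewrite /fb -mulrBr -sumrB; congr (_ * _).
by apply: eq_bigr => i _; exact: ip_subr.
Qed.

(** The factor [2] arises from bounding each of the two terms of the divergence by the full
    seminorm. *)
Lemma fb_le v q : L2 q -> `|fb v q| <= 2 * r * nV v * nL q.
Proof.
move=> qL; rewrite normrM gtr0_norm //.
have -> : 2 * r * nV v * nL q = r * (\sum_(i < 2) nV v * nL q).
  by rewrite sum_ord2; ring.
apply: ler_wpM2l; first exact: ltW.
apply: le_trans (ler_norm_sum _ _ _) _; apply: ler_sum => i _.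
apply: le_trans (ip_le (d_L2 _ _) qL) _; apply: ler_wpM2r => //.
exact: le_trans (nL_d_le _ _) (nH_le _ _).
Qed.

(** The error [u - w] first replaces the convecting field, then the convected one. *)
Lemma fa1_diff u w v : HV u -> HV w -> HV v -> (forall i, bd (v i)) ->
  fa1 u u v - fa1 w w v = fa1 (subV u w) u v + fa1 w (subV u w) v.
Proof.
move=> Hu Hw Hv vB.
have Lm i j (z : V) : HV z -> L2 (mul (v i) (z j)).
  by move=> Hz; apply: mul_L2 => //; exact/H_L2/Hz.
rewrite /fa1 -sumrB -big_split; apply: eq_bigr => i _ /=.
rewrite -sumrB -big_split; apply: eq_bigr => j _ /=.
rewrite ip_d_subl ?mul_subr ?ip_subr //; [ring|exact: Lm..].
Qed.

Lemma fa4_diff u w S T theta : HV u -> HV w -> H S -> H T ->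
  H theta -> bd theta ->
  fa4 u S theta - fa4 w T theta =
  fa4 (subV u w) S theta + fa4 w (S - T) theta.
Proof.
move=> Hu Hw HS HT Ht tB.
have Lm j (z : V) : HV z -> L2 (mul theta (z j)).
  by move=> Hz; apply: mul_L2 => //; exact/H_L2/Hz.
rewrite /fa4 -sumrB -big_split; apply: eq_bigr => j _ /=.
rewrite ip_d_subl ?mul_subr ?ip_subr //; [ring|exact: Lm..].
Qed.

Variables (N1 N2 B L : R).
Hypotheses (N1_ge0 : 0 <= N1) (N2_ge0 : 0 <= N2) (B_ge0 : 0 <= B) (L_gt0 : 0 < L).
Hypothesis fa1_le : forall w u v, HV w -> HV u -> HV v ->
  `|fa1 w u v| <= N1 * nV w * nV u * nV v.
Hypothesis fa4_le : forall w T theta, HV w -> H T -> H theta -> bd theta ->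
  `|fa4 w T theta| <= N2 * nV w * nH T * nH theta.
Hypothesis coer_u : 0 < k0 / 2 - (N1 + N2) * B - kg * c ^+ 2.
Hypothesis coer_T : 0 < ka / 2 - kg * c ^+ 2 / 2 - 5 * N2 * B.

Definition form w u p T v theta : R :=
  fa0 u v + fa1 w u v - fb v p - fa2 T v + fa3 T theta + fa4 w T theta.

(** [M] is chosen before the discrete spaces [XV], [QS], [RT], whence its independence of the mesh.
    The inf-sup condition enters as a bound of [nL q] by any bound of the functional [fb _ q]. *)
Lemma galerkin_estimate : exists2 M : R, 0 < M &
  forall (XV : V -> Prop) (QS RT : F -> Prop),
  (forall v, XV v -> HV v /\ forall i, bd (v i)) ->
  (forall u v, XV u -> XV v -> XV (subV u v)) ->
  (forall theta, RT theta -> H theta /\ bd theta) ->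
  (forall S theta, RT S -> RT theta -> RT (S - theta)) ->
  (forall q, QS q -> L2 q) ->
  (forall p q, QS p -> QS q -> QS (p - q)) ->
  (forall q m, QS q -> 0 <= m -> (forall v, XV v -> `|fb v q| <= m * nV v) ->
     r * L * nL q <= m) ->
  forall u p T uh ph Th,
  HV u -> L2 p -> H T -> XV uh -> QS ph -> RT Th ->
  nV u <= B -> nH T <= B -> nV uh <= B -> nH Th <= B ->
  (forall v theta, XV v -> RT theta ->
     form u u p T v theta = form uh uh ph Th v theta) ->
  (forall q, QS q -> fb u q = 0) -> (forall q, QS q -> fb uh q = 0) ->
  forall vI qI SI, XV vI -> QS qI -> RT SI ->
  nV (subV u uh) + nH (T - Th) <=
    M * (nV (subV u vI) + nH (T - SI) + nL (p - qI)).
Proof.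
have G0 : 0 <= kg * c ^+ 2 by rewrite mulr_ge0 ?sqr_ge0 // ltW.
have [M M0 HM] := energy_bound (ltW k0_gt0) (ltW ka_gt0) G0 N1_ge0 N2_ge0 B_ge0
  r_gt0 L_gt0 coer_u coer_T.
exists M => // XV QS RT XH Xsub RH Rsub QL Qsub infsup u p T uh ph Th.
move=> Hu pL HT Xuh Qph RTh uB TB uhB ThB gal bu buh vI qI SI XvI QqI RSI.
have [Huh _] := XH _ Xuh; have [HTh _] := RH _ RTh.
have [HvI _] := XH _ XvI; have [HSI _] := RH _ RSI.
have phL := QL _ Qph; have qIL := QL _ QqI.
have Qpi := Qsub _ _ Qph QqI; have piL := QL _ Qpi.
have He := HV_sub Hu Huh; have Ht := H_sub HT HTh.
have Hx := HV_sub Hu HvI; have Hy := H_sub HT HSI.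
have pqL := L2_sub pL qIL.
set e := subV u uh in He *; set t := T - Th in Ht *.
set x := subV u vI in Hx *; set y := T - SI in Hy *.
(* The error equation: the difference of the two problems, with the convective terms split. *)
have err v theta : XV v -> RT theta ->
  fa0 e v + (fa1 e u v + fa1 uh e v) - (fb v p - fb v ph) - fa2 t v
    + fa3 t theta + (fa4 e T theta + fa4 uh t theta) = 0.
  move=> Xv Rt; have [Hv vB] := XH _ Xv; have [Hth tB] := RH _ Rt.
  rewrite -fa1_diff // -fa4_diff // fa0_subl // fa2_subl ?fa3_subl //; try exact: H_L2.
  by have := gal _ _ Xv Rt; rewrite /form; lra.
have R0 := Rsub _ _ RTh RTh; have [HR0 bR0] := RH _ R0.
have n00 : nH (Th - Th) = 0 by exact: nH_subrr.
have nVe := nV_ge0 e; have nHt := nH_ge0 t.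
have a1e v : XV v ->
    `|fa1 e u v| <= N1 * B * nV e * nV v /\ `|fa1 uh e v| <= N1 * B * nV e * nV v.
  move=> Xv; have [Hv _] := XH _ Xv; split.
    apply: le_trans (fa1_le He Hu Hv) _; apply: ler_wpM2r; first exact: nV_ge0.
    by rewrite -!mulrA; apply: ler_wpM2l => //; rewrite mulrC; apply: ler_wpM2r.
  apply: le_trans (fa1_le Huh He Hv) _; apply: ler_wpM2r; first exact: nV_ge0.
  by apply: ler_wpM2r => //; apply: ler_wpM2l.
(* The error equation with a zero temperature test function and the discrete
   inf-sup condition bound the discrete pressure error. *)
have press : r * L * nL (ph - qI) <=
    2 * r * nL (p - qI) + (k0 + 2 * N1 * B) * nV e + kg * c ^+ 2 * nH t.
  apply: infsup => //.
    have r0 := ltW r_gt0; have k00 := ltW k0_gt0; have n0 := nL_ge0 (p - qI).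
    by do ![assumption | exact: ler0n | apply: addr_ge0 | apply: mulr_ge0].
  move=> v Xv; have [Hv _] := XH _ Xv.
  have := err v _ Xv R0.
  have -> : fa3 t (Th - Th) = 0 by rewrite fa3_subr // subrr.
  have /normr0_eq0 -> : `|fa4 e T (Th - Th)| = 0.
    by apply/eqP; rewrite eq_le normr_ge0 andbT; have := fa4_le He HT HR0 bR0; rewrite n00 mulr0.
  have /normr0_eq0 -> : `|fa4 uh t (Th - Th)| = 0.
    by apply/eqP; rewrite eq_le normr_ge0 andbT; have := fa4_le Huh Ht HR0 bR0; rewrite n00 mulr0.
  move=> ev.
  have -> : fb v (ph - qI) = fb v (p - qI) -
      (fa0 e v + (fa1 e u v + fa1 uh e v) - fa2 t v).
    by rewrite !fb_subr //; lra.
  have [h1 h2] := a1e _ Xv; have h3 := fa0_le e v; have h4 := fa2_le Ht Hv.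
  have h5 := fb_le v pqL.
  move: h1 h2 h3 h4 h5; rewrite !ler_norml.
  move=> /andP[? ?] /andP[? ?] /andP[? ?] /andP[? ?] /andP[? ?].
  by apply/andP; split; lra.
apply: HM press _; try exact: nV_ge0; try exact: nH_ge0; try exact: nL_ge0.
have Xv := Xsub _ _ XvI Xuh; have Rt := Rsub _ _ RSI RTh.
(* The discrete test functions [vI - uh] and [SI - Th] are the errors minus the approximation
   errors. *)
have vE : subV vI uh = subV e x.
  by apply/funext => i; rewrite /e /x /subV opprB [RHS]addrC addrA subrK.
have tE : SI - Th = t - y by rewrite /t /y opprB [RHS]addrC addrA subrK.
have [Hv vB] := XH _ Xv; have [Hth tB] := RH _ Rt.
have nv : nV (subV vI uh) <= nV e + nV x by rewrite vE; exact: nV_sub.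
have nt : nH (SI - Th) <= nH t + nH y by rewrite tE; exact: nH_sub.
have le_trans_mul (k z z' a : R) : 0 <= k -> z <= z' -> a <= k * z -> a <= k * z'.
  by move=> k00 zz h; apply: le_trans h _; exact: ler_wpM2l.
have N1BE : 0 <= N1 * B * nV e by do 2?apply: mulr_ge0.
have [A1 A2] := a1e _ Xv.
have {}A1 := le_trans_mul _ _ _ _ N1BE nv A1.
have {}A2 := le_trans_mul _ _ _ _ N1BE nv A2.
have A3 := le_trans_mul _ _ _ _ (mulr_ge0 G0 nHt) nv (fa2_le Ht Hv).
have A4 : `|fa4 e T (SI - Th)| <= N2 * B * nV e * (nH t + nH y).
  apply: (le_trans_mul _ _ _ _ _ nt); first by do 2?apply: mulr_ge0.
  apply: le_trans (fa4_le He HT Hth tB) _; apply: ler_wpM2r; first exact: nH_ge0.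
  by rewrite -!mulrA; apply: ler_wpM2l => //; rewrite mulrC; apply: ler_wpM2r.
have A5 : `|fa4 uh t (SI - Th)| <= N2 * B * nH t * (nH t + nH y).
  apply: (le_trans_mul _ _ _ _ _ nt); first by do 2?apply: mulr_ge0.
  apply: le_trans (fa4_le Huh Ht Hth tB) _; apply: ler_wpM2r; first exact: nH_ge0.
  by apply: ler_wpM2r => //; apply: ler_wpM2l.
(* [fb e (ph - qI)] vanishes by the two discrete divergence constraints, so the discrete pressure
   error is paired with the approximation error [x] only. *)
have bE : fb (subV vI uh) p - fb (subV vI uh) ph =
    fb e (p - qI) - fb x (p - qI) + fb x (ph - qI).
  have := bu _ Qpi; have := buh _ Qpi; rewrite vE.
  by rewrite /e !fb_subl // !fb_subr // ?fb_subl //; lra.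
have := err _ _ Xv Rt; rewrite bE.
have -> : fa0 e (subV vI uh) = k0 * nV e ^+ 2 - fa0 e x.
  by rewrite vE fa0_subr // fa0_self.
have -> : fa3 t (SI - Th) = ka * nH t ^+ 2 - fa3 t y.
  by rewrite tE fa3_subr // fa3_self.
have := fb_le e pqL; have := fb_le x pqL; have := fb_le x piL.
have := fa0_le e x; have := fa3_le t y.
move: A1 A2 A3 A4 A5; rewrite !ler_norml.
do 10 move=> /andP[? ?].
move=> er; lra.
Qed.
End Galerkin.

(** * Error estimates *)

Section Instance.
Variables (R : realType) (Omega : set (R * R)) (P : nanofluid R).
Notation RR := (measurableTypeR R * measurableTypeR R)%type.
Notation mu := (@leb2 R).
Hypotheses (oO : open Omega) (bO : bounded_set Omega).
Notation intO f := (mu.-integrable Omega (EFin \o f)).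
Notation fn := (R * R -> R).
Implicit Types (f g h T theta q : fn) (u v w : 'I_2 -> fn).

Let mO : measurable (Omega : set RR) := open_measurable2 oO.

Definition ipO f g : R := integ Omega (fun x => f x * g x).
Definition mulO f g : fn := fun x => f x * g x.
Definition bdO f : Prop :=
  exists M : R, {ae mu, forall x, Omega x -> `|f x| <= M}.

Lemma ipOC f g : ipO f g = ipO g f.
Proof. by congr integ; apply/funext => x; rewrite mulrC. Qed.

Lemma ipO_ae f g h : L2 Omega f -> L2 Omega g -> L2 Omega h ->
  ae_eq_on Omega f g -> ipO f h = ipO g h.
Proof.
move=> fL gL hL fg; apply: (ae_integ mO).
- by apply: measurable_funM; exact: (L2_measurable mO).
- by apply: measurable_funM; exact: (L2_measurable mO).
- by apply: filterS fg => x /[apply] ->.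
Qed.

Lemma ipO_subl f g h : L2 Omega f -> L2 Omega g -> L2 Omega h ->
  ipO (f - g) h = ipO f h - ipO g h.
Proof.
move=> fL gL hL; rewrite /ipO -(integ_sub mO); try exact: (L2_mul mO).
by congr integ; apply/funext => x; rewrite mulrBl.
Qed.

Lemma ipO_dx_subl i f g h : H10 Omega f -> H10 Omega g -> L2 Omega h ->
  ipO (dx Omega i (f - g)) h = ipO (dx Omega i f) h - ipO (dx Omega i g) h.
Proof.
move=> [Hf _] [Hg _] hL; have dL k z : L2 Omega (dx Omega k z) by exact: dx_L2.
rewrite -(ipO_subl (dL i f) (dL i g) hL).
by apply: (ipO_ae (dL _ _) _ hL (dx_sub oO bO i Hf Hg)); exact: (L2_sub mO).
Qed.

Lemma mulO_L2 f g : H10 Omega f -> bdO f -> L2 Omega g -> L2 Omega (mulO f g).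
Proof.
move=> [[fL _] _] [M fM] gL; apply: (L2_bounded_mul mO _ fM gL).
exact: (L2_measurable mO fL).
Qed.

Lemma mulO_subr f g h : mulO f (g - h) = mulO f g - mulO f h.
Proof. by apply/funext => x; exact: mulrBr. Qed.

Lemma nHE : nH (L2norm Omega) (dx Omega) = snorm Omega 1.
Proof.
apply/funext => T; rewrite snorm1E /nH sum_ord2.
exact: (congr1 Num.sqrt (addrC _ _)).
Qed.

Lemma nVE : nV (L2norm Omega) (dx Omega) = vsnorm Omega 1.
Proof. by apply/funext => v; rewrite /nV nHE. Qed.

Lemma fa0E u v : a0 Omega P u v =
  fa0 ipO (dx Omega) (ratio_r P * ratio_m P * Pr P) u v.
Proof.
have dd i k z z' : intO (fun x => dx Omega i z x * dx Omega k z' x).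
  by apply: (L2_mul mO); exact: dx_L2.
congr (_ * _); rewrite (integ_sum mO) => [|i].
  by apply: eq_bigr => i _; rewrite (integ_sum mO).
exact: (intO_sum mO).
Qed.

Lemma fa1E w u v : a1 Omega w u v = fa1 ipO (dx Omega) mulO w u v.
Proof.
apply: eq_bigr => i _; apply: eq_bigr => j _.
by congr integ; apply/funext => x; rewrite /mulO mulrAC [LHS]mulrC (mulrC (w j x)).
Qed.

Lemma fa2E T v : a2 Omega P T v = fa2 ipO (ratio_g P * Pr P * Ra P) T v.
Proof.
congr (_ * integ _ _); apply/funext => x; rewrite sum_ord2 /jvec /=.
by rewrite !mul0r add0r mul1r.
Qed.

Lemma fa3E T theta : a3 Omega P T theta = fa3 ipO (dx Omega) (ratio_a P) T theta.
Proof.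
congr (_ * _); rewrite (integ_sum mO) // => j.
by apply: (L2_mul mO); exact: dx_L2.
Qed.

(** In [a4] the sum over the directions stands under the integral. Boundedness of [theta] makes each
    summand integrable, so that the sum can be taken out. *)
Lemma fa4E w T theta : vH10 Omega w -> H10 Omega theta -> bdO theta ->
  a4 Omega w T theta = fa4 ipO (dx Omega) mulO w T theta.
Proof.
move=> Hw Ht tB; rewrite /fa4 /ipO -(integ_sum mO) => [|j].
  congr integ; apply/funext => x; rewrite mulr_suml; apply: eq_bigr => j _.
  by rewrite /mulO mulrAC [LHS]mulrC (mulrC (w j x)).
apply: (L2_mul mO); first exact: dx_L2.
by apply: mulO_L2 => //; have [[]] := Hw j.
Qed.

Lemma fbE v q : L2 Omega q -> b Omega P v q = fb ipO (dx Omega) (ratio_r P) v q.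
Proof.
move=> qL; congr (_ * _); rewrite /ipO -(integ_sum mO) => [|i].
  by congr integ; apply/funext => x; rewrite /wdiv mulr_suml.
by apply: (L2_mul mO) => //; exact: dx_L2.
Qed.

(** For [q] of nonzero norm, every quotient is at most [m / (r ||q||)]. Hence so is their supremum,
    which lies above the infimum over all pressures. *)
Lemma inf_sup_le (tau : set (set (R * R))) (c m : R) q : 0 < ratio_r P ->
  inf_sup_condition Omega tau c -> Qh Omega tau q -> 0 <= m ->
  (forall v, Xh Omega tau v -> `|b Omega P v q| <= m * vsnorm Omega 1 v) ->
  ratio_r P * c * L2norm Omega q <= m.
Proof.
move=> r0 hc Qq m0 hm; have qL : L2 Omega q by case: Qq => [[]].
have [->|q0] := eqVneq (L2norm Omega q) 0; first by rewrite mulr0.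
have qp : 0 < L2norm Omega q by rewrite lt0r q0 L2norm_ge0.
have qn : ~ ae_eq_on Omega q (cst 0).
  move=> qz; move: q0; rewrite (ae_L2norm mO qL _ qz); last exact: (L2_cst0 mO).
  have := L2norm_scale mO 0 qL; rewrite normr0 mul0r => h.
  suff -> : L2norm Omega (cst 0) = 0 by rewrite eqxx.
  by rewrite -[RHS]h; congr L2norm; apply/funext => x; rewrite mul0r.
suff : (c%:E <= (m / (ratio_r P * L2norm Omega q))%:E)%E.
  rewrite lee_fin ler_pdivlMr; last exact: mulr_gt0.
  by rewrite mulrA (mulrC c).
apply: le_trans hc _; apply: ereal_inf_le.
exists (ereal_sup [set (inf_sup_quotient Omega v q)%:E | v in
    [set v | Xh Omega tau v /\ ~ (forall i, ae_eq_on Omega (v i) (cst 0))]]).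
  by exists q.
apply: ge_ereal_sup => _ [v [Xv _] <-]; rewrite lee_fin /inf_sup_quotient.
have := hm _ Xv; rewrite /b; set I := integ _ _; set N := vsnorm _ _ _ => hI.
(* If the seminorm of [v] vanishes, the quotient is a division by zero, of value [0]. *)
have [->|N0] := eqVneq N 0.
  by rewrite mul0r invr0 mulr0 divr_ge0 // mulr_ge0 // ltW.
have Np : 0 < N by rewrite lt0r N0 sqrtr_ge0.
rewrite ler_pdivrMr ?mulr_gt0 //.
have -> : m / (ratio_r P * L2norm Omega q) * (N * L2norm Omega q) = m * N / ratio_r P.
  by field; rewrite q0 gt_eqF.
by rewrite ler_pdivlMr // mulrC; apply: le_trans hI; exact: ler_norm.
Qed.
End Instance.

(** The infimum need not be attained, whence the slack [e]. *)
Lemma inf_image_lt (R : realType) (I : Type) (A : set I) (f : I -> R) (a e : R) :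
  A !=set0 -> (forall i, 0 <= f i) -> inf [set f i | i in A] <= a -> 0 < e ->
  exists2 i, A i & f i < a + e.
Proof.
move=> [i0 Ai0] f0 infA e0.
have [|_ [i Ai <-] hi] := @inf_adherent _ [set f i | i in A] e e0.
  by split; [exists (f i0), i0|exists 0 => _ [i _ <-]].
by exists i => //; apply: lt_le_trans hi _; rewrite lerD2r.
Qed.

(** Drops the [L2] part [y] of an interpolation estimate and divides by the mesh size [h]. *)
Lemma scaled_bound (R : realFieldType) (h x y K s e : R) : 0 < h -> 0 <= y ->
  y + h * x < K * h ^+ 3 * s + h * e -> x <= K * h ^+ 2 * s + e.
Proof.
move=> h0 y0 hx; rewrite -(ler_pM2l h0); apply: ltW; apply: le_lt_trans (_ : y + h * x < _).
  by rewrite lerDr.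
by have -> : h * (K * h ^+ 2 * s + e) = K * h ^+ 3 * s + h * e by ring.
Qed.

(** Here [l] and [l'] stand for the roots of [L1] and [L2] in either order, and [k1], [k2], [k3] for
    those of [K1], [K2], [K3]. The weight [(l + l') (1/k1 + 1/k3)] is symmetric in [l] and [l'], and
    stays at least [1] after division by [l] and multiplication by [k1] or [k3]. *)
Lemma constants_bound (R : realFieldType) (M l l' k1 k2 k3 z h s1 s2 s3 : R) :
  0 < M -> 0 < l -> 0 <= l' -> 0 < k1 -> 0 < k2 -> 0 < k3 ->
  0 <= h -> 0 <= s1 -> 0 <= s2 -> 0 <= s3 ->
  z <= M * (h * (s1 + s2 + s3)) ->
  z <= M * (l + l') * (k1^-1 + k3^-1) * h / l * (k1 * s1 + k3 * s2)
       + M / k2 * h * k2 * s3.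
Proof.
move=> M0 l0 l'0 k10 k20 k30 h0 s10 s20 s30 /le_trans; apply.
have lk (k k' s : R) : 0 < k -> 0 < k' -> 0 <= s ->
    M * (h * s) <= M * (l + l') * (k^-1 + k'^-1) * h / l * (k * s).
  move=> k0 k'0 s0.
  have -> : M * (l + l') * (k^-1 + k'^-1) * h / l * (k * s) =
    M * (h * s) * ((1 + l' / l) * (1 + k / k')) by field; rewrite !gt_eqF.
  rewrite -[leLHS]mulr1; apply: ler_wpM2l.
    by apply: mulr_ge0; [exact: ltW|exact: mulr_ge0].
  have p1 : 0 <= l' / l by rewrite divr_ge0 // ltW.
  have p2 : 0 <= k / k' by rewrite divr_ge0 // ltW.
  have p3 := mulr_ge0 p1 p2; lra.
have h1 := lk _ _ _ k10 k30 s10; have h2 := lk _ _ _ k30 k10 s20.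
rewrite [k3^-1 + _]addrC in h2.
have -> : M / k2 * h * k2 * s3 = M * (h * s3) by field; rewrite gt_eqF.
by rewrite mulrDr !(mulrDr h) !mulrDr; lra.
Qed.

(** * Quasi-optimality of the finite element solution *)

Section Estimate.
Variables (R : realType) (Omega : set (R * R)) (P : nanofluid R).
Hypotheses (oO : open Omega) (bO : bounded_set Omega).
Variables (N1 N2 c L B : R).
Hypotheses (N1_ge0 : 0 <= N1) (N2_ge0 : 0 <= N2) (B_ge0 : 0 <= B) (L_gt0 : 0 < L).
Hypothesis a1_le : forall w u v : 'I_2 -> R * R -> R,
  vH10 Omega w -> vH10 Omega u -> vH10 Omega v ->
  `|a1 Omega w u v| <= N1 * vsnorm Omega 1 w * vsnorm Omega 1 u * vsnorm Omega 1 v.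
Hypothesis a4_le : forall (u : 'I_2 -> R * R -> R) (T theta : R * R -> R),
  vH10 Omega u -> H10 Omega T -> H10 Omega theta ->
  `|a4 Omega u T theta| <= N2 * vsnorm Omega 1 u * snorm Omega 1 T * snorm Omega 1 theta.
Hypothesis poincare : forall v : R * R -> R, H10 Omega v ->
  L2norm Omega v <= c * snorm Omega 1 v.
Hypotheses (l1 : 0 < L1_ P N1 N2 c B) (l2 : 0 < L2_ P N2 c B).

Lemma ratio_gt0 : [/\ 0 < ratio_r P, 0 < ratio_m P, 0 < ratio_g P & 0 < ratio_a P].
Proof.
have [] := (rho_f_gt0 P, rho_hnf_gt0 P); have [] := (mu_f_gt0 P, mu_hnf_gt0 P).
have [] := (alpha_f_gt0 P, alpha_hnf_gt0 P).
have [] := (beta_f_gt0 P, rhobeta_hnf_gt0 P).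
by move=> *; split; apply: divr_gt0 => //; apply: mulr_gt0.
Qed.

Lemma quasi_optimality : exists2 M : R, 0 < M &
  forall tau, fe_partition Omega tau -> inf_sup_condition Omega tau L ->
  forall f u p T uh ph Th,
  continuous_solution Omega P f u p T -> discrete_solution Omega P tau f uh ph Th ->
  vsnorm Omega 1 u <= B -> snorm Omega 1 T <= B ->
  vsnorm Omega 1 uh <= B -> snorm Omega 1 Th <= B ->
  forall vI qI SI, Xh Omega tau vI -> Qh Omega tau qI -> Rh Omega tau SI ->
  vsnorm Omega 1 (vsub u uh) + snorm Omega 1 (T \- Th) <=
  M * (vsnorm Omega 1 (vsub u vI) + snorm Omega 1 (T \- SI) + L2norm Omega (p \- qI)).
Proof.
have mO := open_measurable2 oO.
have [r0 m0 g0 ka0] := ratio_gt0.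
have k00 : 0 < ratio_r P * ratio_m P * Pr P.
  by apply: mulr_gt0; [exact: mulr_gt0|exact: Pr_gt0].
have kg0 : 0 < ratio_g P * Pr P * Ra P.
  by apply: mulr_gt0; [apply: mulr_gt0 => //; exact: Pr_gt0|exact: Ra_gt0].
have H_L2 f : H10 Omega f -> L2 Omega f by case=> -[].
have poin f : H10 Omega f ->
    L2norm Omega f <= c * nH (L2norm Omega) (dx Omega) f.
  by move=> Hf; rewrite nHE; exact: (poincare Hf).
have fa1_le (w u v : 'I_2 -> R * R -> R) : HV (H10 Omega) w -> HV (H10 Omega) u ->
    HV (H10 Omega) v -> `|fa1 (ipO Omega) (dx Omega) (@mulO R) w u v| <=
    N1 * nV (L2norm Omega) (dx Omega) w * nV (L2norm Omega) (dx Omega) u *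
    nV (L2norm Omega) (dx Omega) v.
  by move=> Hw Hu Hv; rewrite nVE -fa1E; exact: (a1_le Hw Hu Hv).
have fa4_le (w : 'I_2 -> R * R -> R) (T theta : R * R -> R) :
    HV (H10 Omega) w -> H10 Omega T -> H10 Omega theta -> bdO Omega theta ->
    `|fa4 (ipO Omega) (dx Omega) (@mulO R) w T theta| <=
    N2 * nV (L2norm Omega) (dx Omega) w * nH (L2norm Omega) (dx Omega) T *
    nH (L2norm Omega) (dx Omega) theta.
  by move=> Hw HT Ht tB; rewrite nVE nHE -fa4E //; exact: (a4_le Hw HT Ht).
have [M M0 HM] := galerkin_estimate
  (@L2norm_ge0 R Omega) (@ipOC R Omega)
  (fun f fL => esym (L2norm_sqr fL)) (fun f g => CS_L2 mO (f := f) (g := g))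
  (@ipO_subl R Omega oO) (fun f g => L2_sub mO (f := f) (g := g)) H_L2
  (@H10_sub R Omega oO bO) (fun i f => dx_L2 oO i f) (@ipO_dx_subl R Omega oO bO)
  (@mulO_L2 R Omega oO) (@mulO_subr R) k00 kg0 ka0 r0 poin
  N1_ge0 N2_ge0 B_ge0 L_gt0 fa1_le fa4_le l1 l2.
exists M => // tau part insup f u p T uh ph Th [Hu Hp HT solc] [Xuh Qph RTh sold].
rewrite nVE nHE in HM => uB TB uhB ThB vI qI SI XvI QqI RSI.
have bd2 g : (forall K, tau K -> poly_on 2 K g) -> bdO Omega g.
  exact: piecewise_poly_bounded.
have XH v : Xh Omega tau v -> HV (H10 Omega) v /\ (forall i, bdO Omega (v i)).
  by case=> Hv _ pv; split => // i; apply: bd2 => K; exact: pv.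
have RH g : Rh Omega tau g -> H10 Omega g /\ bdO Omega g.
  by case=> Hg _ pg; split => //; exact: bd2.
have QL q : Qh Omega tau q -> L2 Omega q by case=> -[].
have pL : L2 Omega p by case: Hp.
have RE theta : Rh Omega tau theta -> H10 Omega theta by case.
have XE v : Xh Omega tau v -> vH10 Omega v by case.
have QE q : Qh Omega tau q -> L20 Omega q by case.
pose frm := form (ipO Omega) (dx Omega) (@mulO R)
  (ratio_r P * ratio_m P * Pr P) (ratio_g P * Pr P * Ra P) (ratio_a P) (ratio_r P).
have frmE w u' p' T' v theta : vH10 Omega w -> L2 Omega p' -> Rh Omega tau theta ->
    frm w u' p' T' v theta = a0 Omega P u' v + a1 Omega w u' v - b Omega P v p' -
      a2 Omega P T' v + a3 Omega P T' theta + a4 Omega w T' theta.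
  move=> Hw pL' /RH[Ht tB]; rewrite /frm /form.
  by rewrite -fa0E // -fa1E -fa2E -fa3E // -(fa4E oO T' Hw Ht tB) -(fbE P oO v pL').
(* The discrete spaces are contained in the continuous ones, so both problems can be tested alike;
   [p] and [ph] serve as pressure test functions. *)
have gal v theta : Xh Omega tau v -> Rh Omega tau theta ->
    frm u u p T v theta = frm uh uh ph Th v theta.
  move=> Xv Rt; rewrite (frmE _ _ _ _ _ _ Hu pL Rt).
  rewrite (frmE _ _ _ _ _ _ (XE _ Xuh) (QL _ Qph) Rt).
  have [e1 _] := solc _ _ _ (XE _ Xv) Hp (RE _ Rt).
  have [e2 _] := sold _ _ _ Xv Qph Rt.
  exact: etrans e1 (esym e2).
have infs q m' : Qh Omega tau q -> 0 <= m' ->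
    (forall v, Xh Omega tau v ->
      `|fb (ipO Omega) (dx Omega) (ratio_r P) v q| <= m' * vsnorm Omega 1 v) ->
    ratio_r P * L * L2norm Omega q <= m'.
  move=> Qq m'0 hq; apply: (inf_sup_le oO r0 insup Qq m'0) => v Xv.
  by rewrite (fbE P oO v (QL _ Qq)); exact: hq.
have bu q : Qh Omega tau q -> fb (ipO Omega) (dx Omega) (ratio_r P) u q = 0.
  move=> Qq; rewrite -(fbE P oO u (QL _ Qq)).
  by have [_ e0] := solc _ _ _ Hu (QE _ Qq) HT; exact: e0.
have buh q : Qh Omega tau q -> fb (ipO Omega) (dx Omega) (ratio_r P) uh q = 0.
  move=> Qq; rewrite -(fbE P oO uh (QL _ Qq)).
  by have [_ e0] := sold _ _ _ Xuh Qq RTh; exact: e0.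
exact: (HM (Xh Omega tau) (Qh Omega tau) (Rh Omega tau) XH
  (fun u v => @Xh_sub R Omega tau oO bO u v) RH
  (fun S theta => @Rh_sub R Omega tau oO bO S theta) QL
  (fun p q => @Qh_sub R Omega tau oO bO p q) infs u p T uh ph Th
  Hu pL HT Xuh Qph RTh uB TB uhB ThB gal bu buh vI qI SI XvI QqI RSI).
Qed.
End Estimate.

(** * Interpolation rate and the error bounds *)

Lemma approximation_rate (R : realType) (Omega : set (R * R))
    (tau : set (set (R * R))) (C e : R) (u : 'I_2 -> R * R -> R)
    (p T : R * R -> R) : 0 < mesh_size tau -> interpolation_estimates Omega tau C ->
  Xh Omega tau !=set0 -> Qh Omega tau !=set0 -> Rh Omega tau !=set0 ->
  divfree Omega u -> vHk Omega 3 u -> L20 Omega p -> Hk Omega 2 p ->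
  H10 Omega T -> Hk Omega 3 T -> 0 < e ->
  exists vI qI SI, [/\ Xh Omega tau vI, Qh Omega tau qI, Rh Omega tau SI &
    vsnorm Omega 1 (vsub u vI) + snorm Omega 1 (T \- SI) + L2norm Omega (p \- qI) <=
    C * mesh_size tau ^+ 2 * (vsnorm Omega 3 u + snorm Omega 3 T + snorm Omega 2 p)
    + e].
Proof.
set h := mesh_size tau => h0 est X0 Q0 R0 du u3 p0 p2 HT T3 e0.
(* The velocity and temperature slacks carry a factor [h], as their estimates are divided by [h]
   below. *)
have e3 : 0 < e / 3 by rewrite divr_gt0.
have he : 0 < h * (e / 3) by rewrite mulr_gt0.
have [vI XvI hv] := inf_image_lt X0
  (fun v => addr_ge0 (sqrtr_ge0 _) (mulr_ge0 (ltW h0) (sqrtr_ge0 _)))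
  (interp_velocity est du u3) he.
have [SI RSI hS] := inf_image_lt R0
  (fun S => addr_ge0 (L2norm_ge0 _ _) (mulr_ge0 (ltW h0) (sqrtr_ge0 _)))
  (interp_temperature est HT T3) he.
have [qI QqI hq] := inf_image_lt Q0 (fun q => L2norm_ge0 _ _)
  (interp_pressure est p0 p2) e3.
exists vI, qI, SI; split => //.
have b1 := scaled_bound h0 (sqrtr_ge0 _) hv.
have b2 := scaled_bound h0 (L2norm_ge0 _ _) hS.
apply: le_trans (lerD (lerD b1 b2) (ltW hq)) _.
rewrite -/h; move: (vsnorm Omega 3 u) (snorm Omega 3 T) (snorm Omega 2 p) => x y z.
by rewrite -subr_ge0 [leRHS](_ : _ = 0) //; field.
Qed.
Theorem theorem1 (R : realType) (Omega : set (R * R)) (P : nanofluid R)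
  (meshes : set (set (set (R * R)))) (N1 N2 c L C B : R) :
  bounded_lipschitz_domain Omega ->
  0 <= N1 -> 0 <= N2 ->
  (forall w u v : 'I_2 -> R * R -> R,
     vH10 Omega w -> vH10 Omega u -> vH10 Omega v ->
     `|a1 Omega w u v|
       <= N1 * vsnorm Omega 1 w * vsnorm Omega 1 u * vsnorm Omega 1 v) ->
  (forall (u : 'I_2 -> R * R -> R) (T theta : R * R -> R),
     vH10 Omega u -> H10 Omega T -> H10 Omega theta ->
     `|a4 Omega u T theta|
       <= N2 * vsnorm Omega 1 u * snorm Omega 1 T * snorm Omega 1 theta) ->
  (forall v : R * R -> R, H10 Omega v -> L2norm Omega v <= c * snorm Omega 1 v) ->
  (forall v : 'I_2 -> R * R -> R,
     vH10 Omega v -> vL2norm Omega v <= c * vsnorm Omega 1 v) ->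
  (forall tau, meshes tau -> fe_partition Omega tau) ->
  0 < L -> (forall tau, meshes tau -> inf_sup_condition Omega tau L) ->
  0 < C -> (forall tau, meshes tau -> interpolation_estimates Omega tau C) ->
  0 < L1_ P N1 N2 c B -> 0 < L2_ P N2 c B ->
  exists C1 C2 : R, [/\ 0 < C1, 0 < C2 &
    forall (f : R * R -> R) (u : 'I_2 -> R * R -> R) (p T : R * R -> R)
           (tau : set (set (R * R)))
           (uh : 'I_2 -> R * R -> R) (ph Th : R * R -> R),
    L2 Omega f ->
    unique_continuous_solution Omega P f u p T ->
    divfree Omega u -> vHk Omega 3 u ->
    L20 Omega p -> Hk Omega 2 p ->
    H10 Omega T -> Hk Omega 3 T ->
    meshes tau ->
    discrete_solution Omega P tau f uh ph Th ->
    vsnorm Omega 1 u <= B -> snorm Omega 1 T <= B ->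
    vsnorm Omega 1 uh <= B -> snorm Omega 1 Th <= B ->
    let h := mesh_size tau in
    let data := Num.sqrt (K1_ P N1 N2 B) * vsnorm Omega 3 u
                    + Num.sqrt (K3_ P N2 c B) * snorm Omega 3 T in
    vsnorm Omega 1 (vsub u uh)
      <= C1 * h ^+ 2 / Num.sqrt (L1_ P N1 N2 c B) * data
         + C2 * h ^+ 2 * Num.sqrt (K2_ P) * snorm Omega 2 p
    /\
    snorm Omega 1 (T \- Th)
      <= C1 * h ^+ 2 / Num.sqrt (L2_ P N2 c B) * data
         + C2 * h ^+ 2 * Num.sqrt (K2_ P) * snorm Omega 2 p].
Proof.
move=> dom N1_ge0 N2_ge0 a1_le a4_le poinc _ part L_gt0 infsup C_gt0 interp l1 l2.
have oO := domain_open dom; have bO := domain_bounded dom.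
(* For negative [B] the stability bound on [u] is contradictory, and any constants do. *)
have [B0|Bneg] := leP 0 B; last first.
  exists 1, 1; split=> // f u p T tau uh ph Th _ _ _ _ _ _ _ _ _ _ uB.
  by have := le_lt_trans (sqrtr_ge0 _) (le_lt_trans uB Bneg); rewrite ltxx.
have [M M0 HM] := quasi_optimality oO bO N1_ge0 N2_ge0 B0 L_gt0 a1_le a4_le poinc l1 l2.
have [r0 m0 g0 ka0] := ratio_gt0 P.
have pr0 := Pr_gt0 P; have ra0 := Ra_gt0 P.
have N2B : 0 <= N2 * B := mulr_ge0 N2_ge0 B0.
have k1 : 0 < K1_ P N1 N2 B.
  rewrite /K1_ -addrA; apply: ltr_pwDl; first by do ![apply: mulr_gt0 => //].
  apply: addr_ge0 => //; apply: divr_ge0; last by apply/ltW; do ![apply: mulr_gt0 => //].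
  by apply: mulr_ge0 => //; exact: sqr_ge0.
have k2 : 0 < K2_ P by apply: divr_gt0; do ![apply: mulr_gt0 => //].
have k3 : 0 < K3_ P N2 c B.
  apply: ltr_wpDl; last exact: divr_gt0.
  apply: addr_ge0 => //; apply: divr_ge0 => //.
  by apply: mulr_ge0 (sqr_ge0 _); apply: mulr_ge0 (ltW ra0); exact/ltW/mulr_gt0.
have MC : 0 < M * C by rewrite mulr_gt0.
pose s1 := Num.sqrt (L1_ P N1 N2 c B); pose s2 := Num.sqrt (L2_ P N2 c B).
pose t1 := Num.sqrt (K1_ P N1 N2 B); pose t2 := Num.sqrt (K2_ P).
pose t3 := Num.sqrt (K3_ P N2 c B).
have [s10 s20] : 0 < s1 /\ 0 < s2 by rewrite !sqrtr_gt0.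
have [t10 t20 t30] : [/\ 0 < t1, 0 < t2 & 0 < t3] by rewrite !sqrtr_gt0.
(* The sum [s1 + s2] lets the same [C1] serve both bounds; [t1], [t2] and [t3] compensate for the
   weights in the statement. *)
exists (M * C * (s1 + s2) * (t1^-1 + t3^-1)), (M * C / t2); split.
- by rewrite !mulr_gt0 // addr_gt0 // invr_gt0.
- exact: divr_gt0.
move=> f u p T tau uh ph Th _ [sol _] du u3 p0 p2 HT T3 mtau dsol uB TB uhB ThB.
have h0 := mesh_size_gt0 bO (domain_nonempty dom) (part _ mtau).
have [Xuh Qph RTh _] := dsol.
have rate : vsnorm Omega 1 (vsub u uh) + snorm Omega 1 (T \- Th) <=
    M * C * (mesh_size tau ^+ 2 * (vsnorm Omega 3 u + snorm Omega 3 T + snorm Omega 2 p)).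
  (* Almost optimal approximants, with a slack [e / M] that becomes [e] after multiplication by [M].
     The discrete solution witnesses that the discrete spaces are nonempty. *)
  apply/ler_addgt0Pr => e e0; have eM : 0 < e / M by exact: divr_gt0.
  have [vI [qI [SI [XvI QqI RSI hI]]]] := approximation_rate h0 (interp _ mtau)
    (ex_intro _ _ Xuh) (ex_intro _ _ Qph) (ex_intro _ _ RTh) du u3 p0 p2 HT T3 eM.
  have := HM _ (part _ mtau) (infsup _ mtau) _ _ _ _ _ _ _ sol dsol
    uB TB uhB ThB _ _ _ XvI QqI RSI.
  move=> /le_trans; apply; apply: le_trans (ler_wpM2l (ltW M0) hI) _.
  move: (_ + snorm Omega 2 p) => z; rewrite mulrDr (mulrC M (e / M)) divfK ?gt_eqF //.
  by rewrite !mulrA.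
have h2 : 0 <= mesh_size tau ^+ 2 by exact: sqr_ge0.
have cst_bound l l' z : 0 < l -> 0 <= l' -> z <= M * C * (mesh_size tau ^+ 2 *
    (vsnorm Omega 3 u + snorm Omega 3 T + snorm Omega 2 p)) ->
    z <= M * C * (l + l') * (t1^-1 + t3^-1) * mesh_size tau ^+ 2 / l *
      (t1 * vsnorm Omega 3 u + t3 * snorm Omega 3 T)
      + M * C / t2 * mesh_size tau ^+ 2 * t2 * snorm Omega 2 p.
  by move=> l0 l'0; apply: constants_bound => //; exact: sqrtr_ge0.
split.
- apply: cst_bound => //; first exact: ltW.
  by apply: le_trans rate; rewrite lerDl sqrtr_ge0.
- rewrite (addrC s1 s2); apply: cst_bound => //; first exact: ltW.
  by apply: le_trans rate; rewrite lerDr sqrtr_ge0.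
Qed.
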